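(* There is a planar graph whose geodesic treewidth is at least $5$.
   Context: All graphs are undirected, without loops and multi-edges. A geodesic in a graph $G$ is a path in $G$ that is a shortest path between its two endpoints (a single vertex is a geodesic). A partition $\mathcal{P}$ of $G$ is a set of induced subgraphs (parts) whose vertex sets partition $V(G)$; it is a partition into geodesics if the vertices of each part are exactly the vertices of a geodesic of $G$. The quotient $G/\mathcal{P}$ is the simple graph obtained from $G$ by contracting (identifying) each part into a single vertex, removing loops and multi-edges. The geodesic treewidth of $G$ is the smallest $k$ for which there is a partition $\mathcal{P}$ of $G$ into geodesics such that $G/\mathcal{P}$ has treewidth $k$. *)

(* Defs.v *)
From HB Require Import structures.
From mathcomp Require Import all_boot all_order all_algebra.
From mathcomp Require Import all_classical all_reals all_analysis.
Import numFieldNormedType.Exports.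

Set Implicit Arguments.
Unset Strict Implicit.
Unset Printing Implicit Defensive.

Import Order.TTheory GRing.Theory Num.Theory.

Record sgraph := SGraph {
  svertex :> finType;
  adj : rel svertex;
  adj_sym : symmetric adj;
  adj_irrefl : irreflexive adj }.

Definition edges (G : sgraph) : {set {set G}} :=
  [set [set p.1; p.2]%SET | p : G * G & adj p.1 p.2]%SET.

(* Paths, given as a start vertex and the sequence of remaining vertices. *)
Definition gpath (G : sgraph) (x : G) (p : seq G) : Prop :=
  path (@adj G) x p /\ uniq (x :: p).

Definition geodesic (G : sgraph) (x : G) (p : seq G) : Prop :=
  gpath x p /\
  forall q : seq G, gpath x q -> last x q = last x p -> size p <= size q.

Definition geodesic_partition (G : sgraph) (P : {set {set G}}) : Prop :=
  finset.partition P [set: G]%SET /\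
  forall A : {set G}, A \in P ->
    exists (x : G) (p : seq G), geodesic x p /\ A = [set z in x :: p]%SET.

Section Quotient.
Variables (G : sgraph) (P : {set {set G}}).

Definition qadj : rel {A : {set G} | A \in P} := fun A B =>
  (A != B) && [exists x in val A, exists y in val B, adj x y].

Lemma qadj_sym : symmetric qadj.
Proof.
move=> A B; rewrite /qadj eq_sym; congr (_ && _).
by apply/exists_inP/exists_inP => -[x xA /exists_inP[y yB xy]];
  exists y => //; apply/exists_inP; exists x => //; rewrite adj_sym.
Qed.

Lemma qadj_irrefl : irreflexive qadj.
Proof. by move=> A; rewrite /qadj eqxx. Qed.

Definition quotient_graph : sgraph := SGraph qadj_sym qadj_irrefl.

End Quotient.

Definition connected_in (G : sgraph) (S : {set G}) : Prop :=
  forall x y : G, x \in S -> y \in S ->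
    connect [rel a b | [&& a \in S, b \in S & adj a b]] x y.

(* [ucycle] also accepts the back-and-forth walk along a single edge, a
   duplicate-free cyclic sequence of size 2, which is not a cycle of a graph. *)
Definition acyclic (G : sgraph) : Prop :=
  forall c : seq G, ucycle (@adj G) c -> size c < 3.

Definition is_tree (D : sgraph) : Prop :=
  0 < #|D| /\ connected_in [set: D]%SET /\ acyclic D.

Definition tree_decomposition (G D : sgraph) (bag : D -> {set G}) : Prop :=
  is_tree D /\
  (forall v : G, exists t : D, v \in bag t) /\
  (forall u v : G, adj u v -> exists t : D, u \in bag t /\ v \in bag t) /\
  (forall v : G, connected_in [set t | v \in bag t]%SET).

(* Predecessor is truncated, so the graph without vertices gets width 0. *)
Definition width (G D : sgraph) (bag : D -> {set G}) : nat :=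
  (\max_(t : D) #|bag t|).-1.

Definition has_tree_decomposition (G : sgraph) (k : nat) : Prop :=
  exists (D : sgraph) (bag : D -> {set G}),
    tree_decomposition bag /\ width bag = k.

Lemma has_tree_decomposition_ex (G : sgraph) :
  exists k, `[< has_tree_decomposition G k >].
Proof.
have s0 : symmetric (fun _ _ : unit => false) by [].
have i0 : irreflexive (fun _ _ : unit => false) by [].
pose D := SGraph s0 i0; pose bag (_ : D) : {set G} := [set: G]%SET.
exists (width bag); apply/asboolP; exists D, bag; split=> //; split.
  split; first by rewrite card_unit.
  split; first by move=> [] [] _ _; exact: connect0.
  by case=> [|x [|y c]] //= /andP[].
split; first by move=> v; exists tt; rewrite inE.
split; first by move=> u v _; exists tt; rewrite !inE.
by move=> v [] [] _ _; exact: connect0.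
Qed.

Definition treewidth (G : sgraph) : nat := ex_minn (has_tree_decomposition_ex G).

Definition has_geodesic_quotient (G : sgraph) (k : nat) : Prop :=
  exists P : {set {set G}},
    geodesic_partition P /\ treewidth (quotient_graph P) = k.

Lemma has_geodesic_quotient_ex (G : sgraph) :
  exists k, `[< has_geodesic_quotient G k >].
Proof.
pose P : {set {set G}} := [set [set x] | x : G]%SET.
exists (treewidth (quotient_graph P)); apply/asboolP; exists P; split=> //.
split; last first.
  move=> A /imsetP[x _ ->]; exists x, [::]; split; first by do !split.
  by apply/setP => z; rewrite !inE.
apply/and3P; split.
- rewrite finset.eqEsubset finset.subsetT; apply/fintype.subsetP => x _.
  by apply/bigcupP; exists [set x]%SET; rewrite ?imset_f ?finset.set11.
- apply/finset.trivIsetP => _ _ /imsetP[x _ ->] /imsetP[y _ ->] xy.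
  by rewrite disjoints1 inE; apply: contraNneq xy => ->.
- by apply/imsetP => -[x _ /setP /(_ x)]; rewrite !inE eqxx.
Qed.

Definition geodesic_treewidth (G : sgraph) : nat :=
  ex_minn (has_geodesic_quotient_ex G).

Local Open Scope classical_set_scope.
Local Open Scope ring_scope.

(* A drawing sends vertices to points and each edge, an unordered pair, to an
   arc parametrized by [0, 1], in either of its two orientations. *)
Definition plane_drawing (R : realType) (G : sgraph)
    (pos : G -> R * R) (arc : {set G} -> R -> R * R) : Prop :=
  injective pos /\
  (forall E, E \in edges G ->
     [/\ {within `[0, 1], continuous (arc E)},
         {in `[0, 1] &, injective (arc E)},
         arc E @` [set 0; 1] = pos @` [set` E] &
         forall (t : R) (v : G), t \in `]0, 1[ -> arc E t <> pos v]) /\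
  (forall E F, E \in edges G -> F \in edges G -> E != F ->
     forall s t : R, s \in `]0, 1[ -> t \in `]0, 1[ -> arc E s <> arc F t).

Definition planar (R : realType) (G : sgraph) : Prop :=
  exists (pos : G -> R * R) (arc : {set G} -> R -> R * R),
    plane_drawing pos arc.

(* Main.v *)
From Stdlib Require Import ZArith.
From HB Require Import structures.
Require Import Defs.
From mathcomp Require Import all_boot all_order all_algebra.
From mathcomp Require Import all_classical all_reals all_analysis.
From mathcomp Require Import zify ssrZ ring lra.

(** Let [H] be a plane graph with a spanning tree, and replace every edge of
    [H] outside the tree by a path longer than the diameter of the tree. A
    geodesic then meets the vertices of [H] in a path of the tree, and at a
    vertex with many children such a path uses at most two of the tree edges
    towards them, because siblings are pairwise at distance two.

    The tree used here has a root [b] with children [q_c] and [p_{c,i}]; every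
    [p_{c,i}] has children [x_j] and [q_c] has, for each [i], children [y_j]. The
    long edges turn the [x_j] and [y_j] of each sector [(c, i)] into a ladder and
    join the two ends of its [y]-side to [b]. There are three values of [c],
    of [i], and of the block of five consecutive columns [j], so for each of the
    three choices one value is missed by the part in question: the part of [b]
    misses [q_c] and all [p_{c,i}], the part of [q_c] misses the [y_j] of sector
    [(c, i)], and the part of [p_{c,i}] misses the [x_j] of a block. In the
    quotient the vertices [b], [p], [q] and those of the chosen block then lie in
    distinct parts. Contracting the remaining [y_j] into [b] leaves a
    2 x 5 ladder whose sides are dominated by [p] and by [q], closed up to
    a ring by [b]. This 13-vertex minor has a bramble of order 6. *)

Set Implicit Arguments.
Unset Strict Implicit.
Unset Printing Implicit Defensive.

(** * Tree decompositions and brambles *)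

Lemma periodic_point (T : finType) (f : T -> T) (x : T) :
  exists y, fcycle f (orbit f y).
Proof.
have /loopingP/(_ (order f x)) := looping_order f x.
move=> /trajectP[i lti E].
exists (iter i f x); apply/(orbitPcycle 3 0).
exists (order f x - i).-1.
by rewrite prednK ?subn_gt0// -iterD subnK // ltnW.
Qed.

Section Trees.
Variable D : sgraph.

Definition avoids (t : D) : rel D := [rel a b | [&& a != t, b != t & adj a b]].

(** Both walks survive the deletion of the edge between [s] and [t], so together they would join its
    ends without it, and the edge would close a cycle. *)
Lemma acyclic_bridge (s t w : D) : acyclic D -> adj s t ->
  connect (avoids t) s w -> connect (avoids s) t w -> False.
Proof.
move=> acD st sw tw.
(* [e] is adjacency with the edge between [s] and [t] deleted. *)
pose e := [rel a b : D |
  [&& adj a b, (a == s) ==> (b != t) & (a == t) ==> (b != s)]].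
have esym : symmetric e.
  move=> a b; rewrite /e /= adj_sym.
  by case: (a == s); case: (a == t); case: (b == s); case: (b == t).
have : connect e s t.
  apply: (connect_trans (y := w)).
    apply: connect_sub sw => a b /and3P[na nb ab]; apply: connect1.
    by rewrite /= ab nb (negbTE na) implybT.
  rewrite (sym_connect_sym esym).
  apply: connect_sub tw => a b /and3P[na nb ab]; apply: connect1.
  by rewrite /= ab nb (negbTE na) implybT.
move=> /connectP[p0 p0P p0t]; case: (shortenP p0P) p0t => p pP up _ pt.
have adjp : path (@adj D) s p by apply: sub_path pP => a b /and3P[].
have /acD : ucycle (@adj D) (s :: p).
  by rewrite /ucycle up andbT /cycle rcons_path adjp -pt adj_sym.
case: p pP pt {up adjp} => [|a [|b p]] //= pP pt _.
  by move: st; rewrite pt adj_irrefl.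
by move: pP; rewrite -pt !eqxx /= andbF.
Qed.

(** If no node is common, every node [t] misses some [N i], and an arrow leads from [t] to its
    neighbour on the side of that set. Following arrows in a finite tree ends in an edge traversed
    both ways; the two sets its arrows point to then lie on opposite sides of it and cannot meet. *)
Lemma tree_helly (I : Type) (N : I -> {set D}) : is_tree D -> inhabited I ->
  (forall i, connected_in (N i)) ->
  (forall i j, exists t, t \in N i /\ t \in N j) ->
  exists t, forall i, t \in N i.
Proof.
move=> [_ [conD acD]] [i0] conN meetN; apply: contrapT => none.
have step t : exists t', adj t t' /\
    exists i, forall w, w \in N i -> connect (avoids t) t' w.
  have [i Nit] : exists i, t \notin N i.
    apply: contrapT => Nt; apply: none; exists t => i.
    by apply: contrapT => /negP ?; apply: Nt; exists i.
  have [w [wN _]] := meetN i i.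
  have /connectP[p0 p0P p0w] : connect (@adj D) t w.
    by apply: connect_sub (conD t w _ _); rewrite ?inE // => a b /and3P[_ _ /connect1].
  case: (shortenP p0P) p0w => p pP up _ pw.
  case: p pP up pw => [|t' p] /= => [_ _ e|/andP[tt' pP] /and3P[tp _ _] pw].
    by rewrite e in wN; rewrite wN in Nit.
  exists t'; split => //; exists i => w' w'N.
  have nN a : a \in N i -> a != t by apply: contraTneq => ->.
  apply: (connect_trans (y := w)).
    apply/connectP; exists p => //.
    elim: p (t') tp pP {pw tt'} => //= a p IHp b.
    rewrite !inE !negb_or => /and3P[tb ta tp] /andP[ba pP].
    apply/andP; split; last by apply: IHp; rewrite // inE negb_or ta.
    by apply/and3P; split; rewrite // eq_sym.
  apply: connect_sub (conN i w w' wN w'N) => a b /and3P[aN bN ab].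
  by apply: connect1; rewrite /avoids /= !nN.
have [f fP] := choice step.
have [t0 _] := meetN i0 i0.
have [x xcyc] := periodic_point f t0.
have fx : adj x (f x) by case: (fP x).
have ucyc : ucycle (@adj D) (orbit f x).
  rewrite /ucycle orbit_uniq andbT; apply: sub_cycle xcyc => a b /eqP <-.
  by case: (fP a).
have /acD szo := ucyc.
(* Acyclicity bounds the length of the arrow cycle by two, and length one would be a loop. *)
have ffx : f (f x) = x.
  have : iter (fingraph.order f x) f x = x by apply/(orbitPcycle 0 4).
  move: szo (order_gt0 f x); rewrite size_orbit.
  case: (fingraph.order f x) => [|[|[|//]]] //= _ _.
  by move=> e; move: fx; rewrite e adj_irrefl.
have [_ [i iP]] := fP x; have [_ [j jP]] := fP (f x).
have [w [wi wj]] := meetN i j.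
apply: (acyclic_bridge (w := w) acD fx).
  by have := jP _ wj; rewrite ffx.
exact: iP.
Qed.

End Trees.

Definition touching (G : sgraph) (S S' : {set G}) : Prop :=
  exists x y, [/\ x \in S, y \in S' & x = y \/ adj x y].

(** The nodes whose bags meet [S i] form a subtree, and touching sets give intersecting subtrees
    because adjacent vertices share a bag. The Helly property then provides the node. *)
Lemma bramble_bag (G D : sgraph) (bag : D -> {set G}) (I : Type)
    (S : I -> {set G}) :
  tree_decomposition bag -> inhabited I ->
  (forall i, connected_in (S i)) -> (forall i j, touching (S i) (S j)) ->
  exists t, forall i, exists2 x, x \in S i & x \in bag t.
Proof.
move=> [treeD [coverV [coverE conbag]]] I0 conS touchS.
pose N i : {set D} := [set t | [exists x in S i, x \in bag t]]%SET.
have NP i t : reflect (exists2 x, x \in S i & x \in bag t) (t \in N i).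
  by rewrite inE; exact: exists_inP.
suff [t tP] : exists t, forall i, t \in N i by exists t => i; exact/NP.
apply: tree_helly treeD I0 _ _ => [i t t' /NP[x xS xt] /NP[x' xS' xt']|i j]; last first.
  have [x [y [xS yS [exy|xy]]]] := touchS i j.
    have [t xt] := coverV x; exists t; split; apply/NP; exists x => //.
    by rewrite exy.
  have [t [xt yt]] := coverE _ _ xy.
  by exists t; split; apply/NP; [exists x|exists y].
have inbag u s s' : u \in S i -> u \in bag s -> u \in bag s' ->
    connect [rel a b | [&& a \in N i, b \in N i & adj a b]] s s'.
  move=> uS us us'; apply: connect_sub (conbag u s s' _ _); rewrite ?inE //.
  move=> a b; rewrite /= !inE => /and3P[ua ub ab]; apply: connect1.
  by apply/and3P; split=> //; apply/NP; exists u.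
have /connectP[p] := conS i x x' xS xS'.
elim: p x t xS xt => [|y p IHp] x t xS xt /=.
  by move=> _ e; apply: inbag xS xt _; rewrite -e.
move=> /andP[/and3P[_ yS xy] pP] e.
have [s [xs ys]] := coverE _ _ xy.
exact: connect_trans (inbag x t s xS xt xs) (IHp y s yS ys pP e).
Qed.

Definition lift_bag (G D : sgraph) (P : {set {set G}})
    (bag : D -> {set quotient_graph P}) (t : D) : {set G} :=
  [set z | [exists A in bag t, z \in val A]]%SET.

(** A lifted bag contains [z] exactly when the original bag contains the part of [z]. Brambles can
    therefore live in [G], while bag sizes are still counted in parts. *)
Lemma lift_bag_decomposition (G D : sgraph) (P : {set {set G}})
    (bag : D -> {set quotient_graph P}) :
  finset.partition P [set: G]%SET -> tree_decomposition bag ->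
  tree_decomposition (lift_bag bag).
Proof.
move=> /and3P[/eqP coverP trivP _] [treeD [coverV [coverE conbag]]].
have blockP z : finset.pblock P z \in P by rewrite pblock_mem // coverP inE.
pose part z : quotient_graph P := exist (fun A => A \in P) _ (blockP z).
have partP z (A : quotient_graph P) : (z \in val A) = (A == part z).
  apply/idP/eqP => [zA|->]; last by rewrite mem_pblock coverP inE.
  by apply/val_inj/esym/def_pblock => //; exact: valP.
have liftP z t : (z \in lift_bag bag t) = (part z \in bag t).
  rewrite inE; apply/exists_inP/idP => [[A At]|zt].
    by rewrite partP => /eqP <-.
  by exists (part z); rewrite // partP.
split=> //; split.
  by move=> z; have [t zt] := coverV (part z); exists t; rewrite liftP.
split=> [u v uv|z].
  have [euv|nuv] := eqVneq (part u) (part v).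
    have [t ut] := coverV (part u); exists t.
    by rewrite !liftP -euv.
  have [t [ut vt]] : exists t, part u \in bag t /\ part v \in bag t.
    apply: coverE; rewrite /= /qadj nuv; apply/exists_inP; exists u.
      by rewrite partP.
    by apply/exists_inP; exists v; rewrite // partP.
  by exists t; rewrite !liftP.
have -> : [set t | z \in lift_bag bag t]%SET = [set t | part z \in bag t]%SET.
  exact/eq_finset/liftP.
exact: conbag.
Qed.

(** * Brambles of a minor given by vertex labels *)

Section MinorBramble.
Variables (G : sgraph) (P : {set {set G}}) (J : eqType).
Variables (label : G -> option J) (adjJ : rel J).

Definition fiber (a : J) : {set G} := [set z | label z == Some a]%SET.

Definition fibers (s : seq J) : {set G} :=
  [set z | has (fun a => label z == Some a) s]%SET.

(** A certificate of connectedness that can be evaluated: the order of the list must attach each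
    entry to an earlier one. *)
Fixpoint chained (acc s : seq J) : bool :=
  if s is a :: s' then has (fun b => adjJ b a) acc && chained (a :: acc) s'
  else true.

Definition connected_seq (s : seq J) : bool :=
  if s is a :: s' then chained [:: a] s' else false.

Definition touching_seq (s s' : seq J) : bool :=
  has (fun a => has (adjJ a) s') s.

Hypothesis fiber_conn : forall a, connected_in (fiber a).
Hypothesis fiber_adj : forall a b, adjJ a b -> touching (fiber a) (fiber b).

Lemma fiber_sub a s : a \in s -> fiber a \subset fibers s.
Proof.
move=> sa; apply/fintype.subsetP => z; rewrite !inE => za.
by apply/hasP; exists a.
Qed.

Lemma connect_sub_in (S S' : {set G}) x y : S \subset S' ->
  connect [rel a b | [&& a \in S, b \in S & adj a b]] x y ->
  connect [rel a b | [&& a \in S', b \in S' & adj a b]] x y.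
Proof.
move=> /fintype.subsetP SS'; apply: connect_sub => a b /and3P[aS bS ab].
by apply: connect1; rewrite /= !SS'.
Qed.

Lemma chained_connected acc s :
  connected_in (fibers acc) -> chained acc s -> connected_in (fibers (acc ++ s)).
Proof.
elim: s acc => [|a s IHs] acc conacc /=; first by rewrite cats0.
move=> /andP[/hasP[b bacc ba] ch].
have -> : fibers (acc ++ a :: s) = fibers ((a :: acc) ++ s).
  by apply/setP => z; rewrite !inE /= !has_cat /= orbCA.
apply: IHs => //.
have [u [v [ub va uv]]] := fiber_adj ba.
have subacc : fibers acc \subset fibers (a :: acc).
  by apply/fintype.subsetP => z; rewrite !inE /= => ->; rewrite orbT.
have uacc : u \in fibers acc by move/fintype.subsetP: (fiber_sub bacc); apply.
have vnew : v \in fibers (a :: acc).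
  by move/fintype.subsetP: (@fiber_sub a (a :: acc) (mem_head _ _)); apply.
have unew : u \in fibers (a :: acc) by move/fintype.subsetP: subacc; apply.
set e := [rel x y | [&& x \in fibers (a :: acc), y \in fibers (a :: acc) & adj x y]].
have esym : symmetric e.
  by move=> x y; rewrite /e /= adj_sym; case: (x \in _); case: (y \in _).
have toU z : z \in fibers (a :: acc) -> connect e z u.
  rewrite inE /= => /orP[za|zacc].
    have zv : connect e z v.
      apply: (connect_sub_in (fiber_sub (mem_head a acc))).
      by apply: fiber_conn; rewrite // inE.
    case: uv => [uv|uv]; first by rewrite uv.
    apply: connect_trans zv (connect1 _).
    by rewrite /e /= unew vnew adj_sym.
  by apply: (connect_sub_in subacc); apply: conacc; rewrite // inE.
move=> x y xS yS; apply: connect_trans (toU x xS) _.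
by rewrite (sym_connect_sym esym) toU.
Qed.

Lemma connected_seq_fibers s : connected_seq s -> connected_in (fibers s).
Proof.
case: s => [//|a s] /= ch; rewrite -cat1s; apply: chained_connected => //.
have -> : fibers [:: a] = fiber a by apply/setP => z; rewrite !inE /= orbF.
exact: fiber_conn.
Qed.

Lemma touching_seq_fibers s s' :
  touching_seq s s' -> touching (fibers s) (fibers s').
Proof.
move=> /hasP[a sa /hasP[b sb ab]].
have [u [v [ua vb uv]]] := fiber_adj ab; exists u, v; split => //.
  by move/fintype.subsetP: (fiber_sub sa); apply.
by move/fintype.subsetP: (fiber_sub sb); apply.
Qed.

Hypothesis label_block : forall A z w,
  A \in P -> z \in A -> w \in A -> label z = label w.

(** Labels are constant on parts, so a bag whose parts meet all members of the lifted bramble yields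
    at most one label per part, and these labels hit [B]. *)
Lemma quotient_hitting (D : sgraph) (bag : D -> {set quotient_graph P})
    (k : nat) (B : seq (seq J)) :
  finset.partition P [set: G]%SET -> tree_decomposition bag ->
  (forall t, #|bag t| <= k) -> B != [::] -> all connected_seq B ->
  all (fun s => all (touching_seq s) B) B ->
  exists2 X : seq J, size X <= k & all (has (mem X)) B.
Proof.
move=> partP decD bagk B0 /allP conB /allP touchB.
have I0 : inhabited {s | s \in B}.
  by case: (B) B0 => // s B' _; constructor; exists s; rewrite mem_head.
have [|i j|t tP] := bramble_bag (S := fun i : {s | s \in B} => fibers (val i))
  (lift_bag_decomposition partP decD) I0.
- by move=> [s sB]; exact/connected_seq_fibers/conB.
- apply: touching_seq_fibers.
  by have /allP := touchB _ (valP i); apply; exact: valP.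
(* The label of a part is read off at any of its vertices; unlabelled parts are dropped by
   [pmap]. *)
pose lab (A : quotient_graph P) :=
  if [pick z in val A] is Some z then label z else None.
exists (pmap lab (enum (bag t))).
  by rewrite size_pmap; apply: leq_trans (count_size _ _) _; rewrite -cardE.
apply/allP => s sB; have [x xs] := tP (exist _ s sB).
rewrite inE => /exists_inP[A At xA].
move: xs; rewrite inE => /hasP[a sa /eqP xa]; apply/hasP; exists a => //=.
rewrite mem_pmap; apply/mapP; exists A; first by rewrite mem_enum.
rewrite /lab; case: pickP => [z zA|/(_ x)]; last by rewrite xA.
by rewrite -xa; exact: label_block (valP A) _ _.
Qed.

End MinorBramble.

(** * Connected partitions of subdivided graphs *)

Section Subdivision.
Variables (H E : finType) (short : rel H) (src tgt : E -> H).
Hypotheses (short_sym : symmetric short) (short_irr : irreflexive short).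

(** Four inner vertices per long edge, numbered from the source, make it a path of length five, one
    more than the diameter of a tree of depth two. *)
Definition sub_vertex : finType := (H + E * 'I_4)%type.

Definition incident (u : H) (e : E) (k : 'I_4) : bool :=
  (u == src e) && (k == 0 :> nat) || (u == tgt e) && (k == 3 :> nat).

Definition sub_adj : rel sub_vertex := fun z w =>
  match z, w with
  | inl u, inl v => short u v
  | inl u, inr (e, k) => incident u e k
  | inr (e, k), inl u => incident u e k
  | inr (e, k), inr (e', k') => (e == e') && ((k.+1 == k') || (k'.+1 == k))
  end.

Lemma sub_adj_sym : symmetric sub_adj.
Proof.
by move=> [u|[e k]] [v|[e' k']] //=; rewrite eq_sym orbC.
Qed.

Lemma sub_adj_irrefl : irreflexive sub_adj.
Proof.
by move=> [u|[e k]] //=; rewrite eqxx orbb eqn_leq ltnn.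
Qed.

Definition subdivision : sgraph := SGraph sub_adj_sym sub_adj_irrefl.

Definition joined (u v : H) : Prop :=
  short u v \/ exists e, src e = u /\ tgt e = v \/ src e = v /\ tgt e = u.

Lemma joined_sym u v : joined u v -> joined v u.
Proof.
case=> [uv|[e []]]; first by left; rewrite short_sym.
- by right; exists e; right.
- by right; exists e; left.
Qed.

Section Labels.
Variables (J : eqType) (core : H -> option J) (P : {set {set subdivision}}).
Hypothesis partP : finset.partition P [set: subdivision]%SET.
Hypothesis connP : forall A, A \in P -> connected_in A.
Hypothesis core_inj : forall A h h', A \in P -> core h -> core h' ->
  inl h \in A -> inl h' \in A -> h = h'.
Hypothesis srctgt : forall e, src e != tgt e.

Definition block_core (A : {set subdivision}) : option H :=
  [pick h | core h && (inl h \in A)].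

(** A part inherits the label of its core vertex, which [core_inj] makes unique. A part without one
    that lies inside a long edge between two core vertices is merged into the source side, so that
    the edge still connects the two fibers. *)
Definition label (z : subdivision) : option J :=
  if block_core (finset.pblock P z) is Some h then core h
  else if z is inr (e, _) then (if core (tgt e) then core (src e) else None)
  else None.

Lemma block_pblock (z : subdivision) :
  finset.pblock P z \in P /\ z \in finset.pblock P z.
Proof.
have /and3P[/eqP cP _ _] := partP.
by rewrite pblock_mem ?mem_pblock cP ?inE.
Qed.

Lemma pblock_block A (z : subdivision) : A \in P -> z \in A -> finset.pblock P z = A.
Proof. by have /and3P[_ tP _] := partP; exact: def_pblock. Qed.

Lemma block_coreP A h : A \in P -> core h -> inl h \in A -> block_core A = Some h.
Proof.
move=> AP ch hA; rewrite /block_core; case: pickP => [h' /andP[ch' hA']|].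
  by rewrite (core_inj AP ch' ch).
by move=> /(_ h); rewrite ch hA.
Qed.

Lemma label_core h : core h -> label (inl h) = core h.
Proof.
move=> ch; have [bP bz] := block_pblock (inl h).
by rewrite /label (block_coreP bP ch bz).
Qed.

(** A connected part can leave the interior of a long edge only through one of the ends. *)
Lemma block_inside A e k w : A \in P -> inr (e, k) \in A -> inl (src e) \notin A ->
  inl (tgt e) \notin A -> w \in A -> exists k', w = inr (e, k').
Proof.
move=> AP kA sA tA wA.
have /connectP[p] := connP AP kA wA.
elim: p k {kA wA} => [|z p IHp] k /=; first by move=> _ ->; exists k.
case: z => [u|[e' k']] /andP[/and3P[_ zA]] /=.
  by case/orP=> /andP[/eqP ue _]; move: zA; rewrite ue ?(negbTE sA) ?(negbTE tA).
by move=> /andP[/eqP <- _]; exact: IHp.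
Qed.

(** If the part has a core vertex, that vertex decides. Otherwise a labelled vertex is inside a long
    edge with core ends, the part is confined to that edge by [block_inside], and the label depends
    on the edge alone. *)
Lemma label_block A z w : A \in P -> z \in A -> w \in A -> label z = label w.
Proof.
have aux a b : A \in P -> a \in A -> b \in A -> label a -> label a = label b.
  move=> AP aA bA; rewrite /label !(pblock_block AP) //.
  case eA: (block_core A) => [//|].
  have noc h : core h -> inl h \notin A.
    by move=> ch; apply/negP => hA; rewrite (block_coreP AP ch hA) in eA.
  case: a aA => [//|[e k]] aA; case ct: (core (tgt e)) => [?|//] /= cs.
  have [] := block_inside AP aA (noc _ cs) _ bA; first by rewrite noc ?ct.
  by move=> k' ->; rewrite ct.
move=> AP zA wA; case lz: (label z) => [a|]; first by rewrite -lz; apply: aux; rewrite ?lz.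
by case lw: (label w) => [b|//]; rewrite -lz -lw; apply/esym/aux; rewrite ?lw.
Qed.

(** With the source excluded, the walk inside the part to the target has to pass all later inner
    vertices. *)
Lemma block_climb A e (k : 'I_4) (k' : 'I_4) : A \in P -> inr (e, k) \in A ->
  inl (src e) \notin A -> inl (tgt e) \in A -> k <= k' -> inr (e, k') \in A.
Proof.
move=> AP kA sA tA kk'; apply/negPn/negP => k'A.
have /connectP[p] := connP AP kA tA.
elim: p k kk' {kA} => [|z p IHp] k kk' /=; first by [].
case: z => [u|[e' j]] /andP[/and3P[kA zA]] /=.
  case/orP=> /andP[/eqP ue /eqP k3]; first by rewrite -ue zA in sA.
  have k'k : k' = k by apply/ord_inj/eqP; rewrite eqn_leq kk' k3 -ltnS ltn_ord.
  by rewrite k'k kA in k'A.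
move=> /andP[/eqP ee kj]; rewrite -{}ee in zA *; apply: IHp.
case/orP: kj => /eqP kj; last by rewrite (leq_trans _ kk') // -kj.
rewrite -kj ltn_neqAle kk' andbT; apply: contraNneq k'A => /val_inj <-.
exact: kA.
Qed.

Lemma label_edge e k : core (src e) -> core (tgt e) ->
  label (inr (e, k)) =
  if inl (tgt e) \in finset.pblock P (inr (e, k)) then core (tgt e) else core (src e).
Proof.
move=> cs ct; have [bP bk] := block_pblock (inr (e, k)).
rewrite /label ct; set A := finset.pblock P _ in bP bk *.
case: ifPn => [tA|tA]; first by rewrite (block_coreP bP ct tA).
have [sA|sA] := boolP (inl (src e) \in A).
  by rewrite (block_coreP bP cs sA).
rewrite /block_core; case: pickP => [h /andP[_ hA]|//].
by have [] := block_inside bP bk sA tA hA.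
Qed.

(** If the part of [k'] contained the target, it would climb through [k]. Hence the inner vertices
    whose part avoids the target form an initial segment of the edge. *)
Lemma label_edge_down e (k k' : 'I_4) : core (src e) -> core (tgt e) -> k' <= k ->
  inl (tgt e) \notin finset.pblock P (inr (e, k)) ->
  label (inr (e, k')) = core (src e).
Proof.
move=> cs ct k'k tk; rewrite label_edge //; case: ifPn => // tk'.
have [bP bk'] := block_pblock (inr (e, k')).
have sk' : inl (src e) \notin finset.pblock P (inr (e, k')).
  apply: contra_neqN (srctgt e) => sk'.
  exact: core_inj bP cs ct sk' tk'.
have kb := block_climb bP bk' sk' tk' k'k.
by rewrite (pblock_block bP kb) tk' in tk.
Qed.

Local Notation fib a := (fiber label a).
Local Notation inside a :=
  [rel z w : subdivision | [&& z \in fib a, w \in fib a & adj z w]].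

Lemma edge_prefix e (k : 'I_4) a : core (src e) = Some a ->
  (forall j : 'I_4, j <= k -> label (inr (e, j)) = Some a) ->
  connect (inside a) (inl (src e)) (inr (e, k)).
Proof.
move=> ca; have lsrc : inl (src e) \in fib a by rewrite inE label_core ca.
case: k => k; elim: k => [|k IHk] ltk lab.
  apply: connect1; apply/and3P; split => //; first by rewrite inE lab.
  by rewrite /= /incident eqxx.
have ltk' : k < 4 by exact: ltnW.
apply: connect_trans (IHk ltk' _) _ => [j jk|]; first by rewrite lab // ltnW.
by apply: connect1; apply/and3P; split; rewrite /= ?inE ?lab ?eqxx //=.
Qed.

(** This reduces connectedness of a fiber to its core vertices. A part with a core vertex is itself
    connected; from a part without one the initial segment of its long edge leads back to the
    source. *)
Lemma fiber_to_core a z : z \in fib a ->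
  exists2 h, core h = Some a & connect (inside a) z (inl h).
Proof.
have ssym : symmetric (inside a).
  by move=> x y /=; rewrite sub_adj_sym; case: (x \in _); case: (y \in _).
rewrite inE => /eqP lz; have [bP bz] := block_pblock z.
move: (lz); rewrite {1}/label; case eA: (block_core _) => [h|].
  move: eA; rewrite /block_core; case: pickP => // h' /andP[ch hA] [eh] ca.
  rewrite {h'}eh in ch hA; exists h => //.
  apply: connect_sub (connP bP bz hA) => x y /and3P[xA yA xy]; apply: connect1.
  have lab w : w \in finset.pblock P z -> w \in fib a.
    by move=> wA; rewrite inE -(label_block bP bz wA) lz.
  by apply/and3P; split => //; exact: lab.
case: z eA lz bP bz => [//|[e k]] eA lz bP bz.
case ct: (core (tgt e)) => [b|//] cs; exists (src e) => //.
rewrite (sym_connect_sym ssym); apply: edge_prefix => // j jk.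
have {}cs : core (src e) = Some a by [].
rewrite (@label_edge_down e k) ?cs ?ct //.
by apply/negP => tA; move: eA; rewrite (block_coreP bP _ tA) ?ct.
Qed.

(** The vertices of a long edge carry only the labels of its two ends. If these differ, the vertex
    just before the first one labelled like the target is labelled like the source. *)
Lemma joined_touching a b h h' : joined h h' -> core h = Some a -> core h' = Some b ->
  touching (fib a) (fib b).
Proof.
have touch_sym S S' : @touching subdivision S S' -> touching S' S.
  move=> [x [y [xS yS xy]]]; exists y, x; split=> //.
  by case: xy => [->|xy]; [left|right; rewrite adj_sym].
have edge e a' b' : core (src e) = Some a' -> core (tgt e) = Some b' ->
    touching (fib a') (fib b').
  move=> cs ct.
  pose q (i : nat) : subdivision := if i is j.+1 then
    (if insub j is Some k then inr (e, k) else inl (tgt e)) else inl (src e).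
  have qlab i : (q i \in fib a') || (q i \in fib b').
    case: i => [|j] /=; first by rewrite inE label_core cs ?eqxx.
    case: insubP => [k _ _|_]; last by rewrite !inE label_core ct ?eqxx ?orbT.
    rewrite !inE label_edge ?cs ?ct //.
    by case: ifP; rewrite ?eqxx ?orbT.
  have qadj i : i < 5 -> adj (q i) (q i.+1).
    case: i => [_|j lt5] /=; first by case: insubP => //= k _ k0; rewrite /incident k0 !eqxx.
    case: insubP => [k _ kj|]; last by rewrite -ltnNge => le; have:= leq_trans lt5 le; rewrite ltnn.
    case: insubP => [k' _ kj'|nk] /=; first by rewrite eqxx kj kj' eqxx.
    rewrite /incident eqxx kj /= orbC.
    by case: j lt5 nk {kj} => [|[|[|[|j]]]].
  have q5 : q 5 \in fib b'.
    by rewrite /q /=; case: insubP => //= _; rewrite inE label_core ct ?eqxx.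
  have [i lti /andP[ia ib]] : exists2 i, i < 5 & (q i \in fib a') && (q i.+1 \in fib b').
    have q0 : q 0 \in fib a' by rewrite inE label_core cs ?eqxx.
    have [m mb min] := ex_minnP (ex_intro (fun i => q i \in fib b') 5 q5).
    case: m mb min => [|m] mb min.
      exists 0 => //; rewrite q0 /=.
      have := qlab 1; rewrite orbC; case/orP => // q1a.
      move: q0 mb; rewrite inE => /eqP q0; rewrite inE q0 => /eqP[e'].
      by rewrite -e'.
    exists m; first exact: min.
    rewrite mb andbT; have := qlab m; case/orP => // /min.
    by rewrite ltnn.
  by exists (q i), (q i.+1); split => //; right; exact: qadj.
case=> [hh' ca cb|[e [[<- <-]|[<- <-]]] ca cb]; last 2 first.
- exact: edge ca cb.
- exact: touch_sym (edge _ _ _ cb ca).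
by exists (inl h), (inl h'); split; rewrite ?inE ?label_core ?ca ?cb //; right.
Qed.

Lemma joined_connect a h h' : joined h h' -> core h = Some a -> core h' = Some a ->
  connect (inside a) (inl h) (inl h').
Proof.
have ssym : symmetric (inside a).
  by move=> x y /=; rewrite sub_adj_sym; case: (x \in _); case: (y \in _).
have edge e : core (src e) = Some a -> core (tgt e) = Some a ->
    connect (inside a) (inl (src e)) (inl (tgt e)).
  move=> cs ct.
  have lab j : label (inr (e, j)) = Some a.
    by rewrite label_edge ?cs ?ct ?if_same.
  apply: connect_trans (edge_prefix (k := ord_max) cs _) (connect1 _) => [//|].
  apply/and3P; split; rewrite ?inE ?lab ?label_core ?ct //.
  by rewrite /= /incident !eqxx orbT.
case=> [hh' ca cb|[e [[<- <-]|[<- <-]]] ca cb]; last 2 first.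
- exact: edge ca cb.
- by rewrite (sym_connect_sym ssym); exact: edge cb ca.
by apply: connect1; apply/and3P; split; rewrite ?inE ?label_core ?ca ?cb.
Qed.

End Labels.
End Subdivision.

(** * Geodesics *)

Lemma path_rev_belast (G : sgraph) (y : G) r : path (@adj G) y r ->
  path (@adj G) (last y r) (rev (belast y r)).
Proof. by move=> rP; rewrite rev_path; apply: sub_path rP => a b; rewrite adj_sym. Qed.

Lemma last_rev_belast (T : Type) (y : T) r : last (last y r) (rev (belast y r)) = y.
Proof. by case: r => //= z r; rewrite rev_cons last_rcons. Qed.

Section Geodesics.
Variables (G : sgraph) (x : G) (p : seq G).
Hypothesis geo : geodesic x p.
Local Notation s := (x :: p).

Lemma last_take_geodesic k : k < size s -> last x (take k p) = nth x s k.
Proof.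
move=> ks; rewrite (last_nth x) -[x :: take k p]/(take k.+1 s) size_takel //.
exact: nth_take.
Qed.

Lemma path_drop_geodesic k : k < size s -> path (@adj G) (nth x s k) (drop k p).
Proof.
move=> ks; have [[pP _] _] := geo.
by move: pP; rewrite -{1}(cat_take_drop k p) cat_path last_take_geodesic // => /andP[].
Qed.

(** Replacing the stretch from [i] to [j] by [w] and removing repetitions gives a competing path
    between the ends of the geodesic. *)
Lemma geodesic_infix (i j : nat) (w : seq G) : i <= j < size s ->
  path (@adj G) (nth x s i) w -> last (nth x s i) w = nth x s j ->
  j - i <= size w.
Proof.
move=> /andP[ij js] wP wl; have [[pP _] minp] := geo.
have takeP k : path (@adj G) x (take k p).
  by move: pP; rewrite -{1}(cat_take_drop k p) cat_path => /andP[].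
have is_ : i < size s by apply: leq_ltn_trans js.
have qP : path (@adj G) x (take i p ++ w ++ drop j p).
  by rewrite !cat_path takeP last_take_geodesic //= wP wl path_drop_geodesic.
have ql : last x (take i p ++ w ++ drop j p) = last x p.
  rewrite !last_cat last_take_geodesic // wl -{3}(cat_take_drop j p) last_cat.
  by rewrite last_take_geodesic.
move: ql; case: (shortenP qP) => q q1 q2 sub ql.
have := minp q (conj q1 q2) ql.
move=> /leq_trans/(_ (uniq_leq_size (proj2 (andP q2)) sub)).
rewrite !size_cat size_takel ?size_drop; move: js is_ => /=; lia.
Qed.

Lemma geodesic_adj i : i.+1 < size s -> adj (nth x s i) (nth x s i.+1).
Proof. by move=> ip; have [[/(pathP x)/(_ i ip)]] := geo. Qed.

Lemma geodesic_connected : connected_in [set z in s]%SET.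
Proof.
rewrite /connected_in; set e := (X in connect X).
have esym : symmetric e.
  by move=> u v; rewrite /e /= adj_sym; case: (u \in _); case: (v \in _).
have inS z : (z \in [set z in s]%SET) = (z \in s) by rewrite finset.in_set.
have fromx k : k < size s -> connect e x (nth x s k).
  elim: k => [|k IHk] ks; first exact: connect0.
  apply: connect_trans (IHk (ltnW ks)) (connect1 _).
  by apply/and3P; split; rewrite ?inS ?mem_nth ?geodesic_adj // ltnW.
move=> u v; rewrite !inS => /(nthP x)[i ip <-] /(nthP x)[j jp <-].
by apply: connect_trans (fromx j jp); rewrite (sym_connect_sym esym) fromx.
Qed.

(** The detour through [a], which may lie off the geodesic, bounds the distance of the positions by
    two; distance one would make [u] and [v] adjacent. *)
Lemma geodesic_gap2 a u v : u \in s -> v \in s -> u != v -> ~~ adj u v ->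
  adj a u -> adj a v ->
  (index v s = index u s + 2 \/ index u s = index v s + 2) /\
  exists m, [/\ m \in s, adj u m & adj m v].
Proof.
wlog le_uv : u v / index u s <= index v s => [hwlog|].
  case/orP: (leq_total (index u s) (index v s)) => le_uv us vs nuv auv au av.
    exact: hwlog.
  have [||//|//|ind [m [ms vm mu]]] := hwlog v u le_uv vs us.
  - by rewrite eq_sym.
  - by rewrite adj_sym.
  by split; [case: ind; [right|left]|exists m; rewrite adj_sym mu adj_sym].
move=> us vs nuv auv au av.
have iu : index u s < size s by rewrite index_mem.
have iv : index v s < size s by rewrite index_mem.
have nu : nth x s (index u s) = u by rewrite nth_index.
have nv : nth x s (index v s) = v by rewrite nth_index.
have le2 : index v s - index u s <= 2.
  have := @geodesic_infix (index u s) (index v s) [:: a; v].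
  rewrite nu nv le_uv iv /= adj_sym au av; exact.
have ne0 : index v s != index u s.
  by apply: contra_neq nuv => e; rewrite -nu -nv e.
have ne1 : index v s != (index u s).+1.
  apply: contraNneq auv => e.
  have := @geodesic_adj (index u s); rewrite -e iv => /(_ isT).
  by rewrite nv nu.
have e2 : index v s = index u s + 2 by lia.
have lt2 : (index u s).+2 < size s by move: iv; rewrite e2 addn2.
split; first by left.
exists (nth x s (index u s).+1); split.
- exact: mem_nth (ltnW lt2).
- by rewrite -{1}nu; exact: geodesic_adj (ltnW lt2).
- by rewrite -nv e2 addn2; exact: geodesic_adj.
Qed.

(** Three positions cannot be pairwise at distance exactly two. *)
Lemma geodesic_no_claw a u v w : u \in s -> v \in s -> w \in s ->
  adj a u -> adj a v -> adj a w -> uniq [:: u; v; w] ->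
  ~~ adj u v -> ~~ adj v w -> ~~ adj u w -> False.
Proof.
move=> us vs ws au av aw /=; rewrite !inE negb_or andbT => /andP[/andP[uv uw] vw] auv avw auw.
have [h1 _] := geodesic_gap2 us vs uv auv au av.
have [h2 _] := geodesic_gap2 vs ws vw avw av aw.
have [h3 _] := geodesic_gap2 us ws uw auw au aw.
lia.
Qed.

(** The witness is the stretch of the geodesic between the two vertices, read backwards if [v] comes
    first. *)
Lemma geodesic_walk u v w : u \in s -> v \in s ->
  path (@adj G) u w -> last u w = v ->
  exists q, [/\ path (@adj G) u q, last u q = v, size q <= size w &
                all (fun z => z \in s) q].
Proof.
move=> us vs wP wl.
have iu : index u s < size s by rewrite index_mem.
have iv : index v s < size s by rewrite index_mem.
have nu : nth x s (index u s) = u by rewrite nth_index.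
have nv : nth x s (index v s) = v by rewrite nth_index.
have main i j : i <= j < size s -> exists q, [/\ path (@adj G) (nth x s i) q,
    last (nth x s i) q = nth x s j, size q = j - i & all (fun z => z \in s) q].
  elim: j => [|j IHj] /andP[ij js].
    by exists [::]; split => //; move: ij; rewrite leqn0 => /eqP ->.
  move: ij; rewrite leq_eqVlt => /orP[/eqP ->|ij].
    by exists [::]; rewrite subnn.
  have [|q [q1 q2 q3 q4]] := IHj; first by rewrite -ltnS ij ltnW.
  exists (rcons q (nth x s j.+1)); split.
  - by rewrite rcons_path q1 q2 geodesic_adj.
  - by rewrite last_rcons.
  - by rewrite size_rcons q3; lia.
  - by rewrite all_rcons q4 mem_nth.
case/orP: (leq_total (index u s) (index v s)) => le_uv.
  have [|q [q1 q2 q3 q4]] := main (index u s) (index v s); first by rewrite le_uv.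
  exists q; rewrite nu nv in q1 q2; split => //.
  rewrite q3; apply: geodesic_infix; rewrite ?le_uv ?nu ?nv //.
have [|q [q1 q2 q3 q4]] := main (index v s) (index u s); first by rewrite le_uv.
rewrite nu nv in q1 q2.
exists (rev (belast v q)); split.
- by rewrite -q2 path_rev_belast.
- by rewrite -q2 last_rev_belast.
- rewrite size_rev size_belast q3.
  have := @geodesic_infix (index v s) (index u s) (rev (belast u w)).
  rewrite le_uv iu nu nv size_rev size_belast; apply => //.
    by rewrite -wl path_rev_belast.
  by rewrite -wl last_rev_belast.
- rewrite all_rev; apply/allP => z /mem_belast; rewrite inE => /orP[/eqP ->//|].
  by move/allP: q4; apply.
Qed.

End Geodesics.

(** * The graph *)

(* [Root], [Low c] and [High c i] are the vertices b, q_c and p_{c,i};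
   [Leaf true c i j] is x_j and [Leaf false c i j] is y_j in sector (c, i). *)
Inductive hub : Type :=
  | Root
  | Low of 'I_3
  | High of 'I_3 & 'I_3
  | Leaf of bool & 'I_3 & 'I_3 & 'I_15.

Definition hub_code (h : hub) : unit + ('I_3 + ('I_3 * 'I_3 + bool * 'I_3 * 'I_3 * 'I_15)) :=
  match h with
  | Root => inl tt
  | Low c => inr (inl c)
  | High c i => inr (inr (inl (c, i)))
  | Leaf t c i j => inr (inr (inr (t, c, i, j)))
  end.

Definition hub_decode (x : unit + ('I_3 + ('I_3 * 'I_3 + bool * 'I_3 * 'I_3 * 'I_15))) : hub :=
  match x with
  | inl _ => Root
  | inr (inl c) => Low c
  | inr (inr (inl (c, i))) => High c i
  | inr (inr (inr (t, c, i, j))) => Leaf t c i j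
  end.

Lemma hub_codeK : cancel hub_code hub_decode.
Proof. by case. Qed.

HB.instance Definition _ := Finite.copy hub (can_type hub_codeK).

Definition parent (h : hub) : hub :=
  match h with
  | Root | Low _ | High _ _ => Root
  | Leaf true c i _ => High c i
  | Leaf false c _ _ => Low c
  end.

Definition short : rel hub := fun u v =>
  (u != v) && ((parent u == v) || (parent v == u)).

Lemma short_sym : symmetric short.
Proof. by move=> u v; rewrite /short eq_sym orbC. Qed.

Lemma short_irr : irreflexive short.
Proof. by move=> u; rewrite /short eqxx. Qed.

(** The boolean of [Lane] selects the x-row or the y-row, as in [Leaf]; that of [Closing] selects
    the last or the first column. *)
Inductive long : Type :=
  | Rung of 'I_3 & 'I_3 & 'I_15
  | Lane of bool & 'I_3 & 'I_3 & 'I_14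
  | Closing of bool & 'I_3 & 'I_3.

Definition long_code (e : long) :
    'I_3 * 'I_3 * 'I_15 + (bool * 'I_3 * 'I_3 * 'I_14 + bool * 'I_3 * 'I_3) :=
  match e with
  | Rung c i j => inl (c, i, j)
  | Lane t c i j => inr (inl (t, c, i, j))
  | Closing r c i => inr (inr (r, c, i))
  end.

Definition long_decode
    (x : 'I_3 * 'I_3 * 'I_15 + (bool * 'I_3 * 'I_3 * 'I_14 + bool * 'I_3 * 'I_3)) : long :=
  match x with
  | inl (c, i, j) => Rung c i j
  | inr (inl (t, c, i, j)) => Lane t c i j
  | inr (inr (r, c, i)) => Closing r c i
  end.

Lemma long_codeK : cancel long_code long_decode.
Proof. by case. Qed.

HB.instance Definition _ := Finite.copy long (can_type long_codeK).

Definition src (e : long) : hub :=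
  match e with
  | Rung c i j => Leaf true c i j
  | Lane t c i j => Leaf t c i (widen_ord (leqnSn 14) j)
  | Closing _ _ _ => Root
  end.

Definition tgt (e : long) : hub :=
  match e with
  | Rung c i j => Leaf false c i j
  | Lane t c i j => Leaf t c i (lift ord0 j)
  | Closing r c i => Leaf false c i (if r then ord_max else ord0)
  end.

Lemma src_tgt e : src e != tgt e.
Proof.
case: e => [c i j|t c i j|r c i] //=.
by apply/eqP => -[]; rewrite /bump /=; lia.
Qed.

Definition witness : sgraph := subdivision src tgt short_sym short_irr.

Lemma parent_neq h : h != Root -> parent h != h.
Proof. by case: h => [|c|c i|[] c i j]. Qed.

Lemma short_parent h : h != Root -> short (parent h) h.
Proof. by move=> h0; rewrite /short eqxx orbT andbT parent_neq. Qed.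

Definition leaf (h : hub) : bool := if h is Leaf _ _ _ _ then true else false.

Lemma short_leaf h u : leaf h -> short h u -> u = parent h.
Proof.
case: h => // t c i j _ /andP[_ /orP[/eqP <-//|/eqP]].
by case: u => [|?|? ?|[] ? ? ?].
Qed.

Lemma siblings_nadj a b : a != Root -> b != Root -> parent a = parent b ->
  ~~ short a b.
Proof.
move=> a0 b0 ab; rewrite /short ab -{2}ab (negbTE (parent_neq b0)).
by rewrite (negbTE (parent_neq a0)) andbF.
Qed.

(* Crossing a subdivided edge takes five steps. *)
Lemma leaf_star h (q : seq witness) : leaf h ->
  path (@adj witness) (inl h) q -> size q <= 4 -> inl (parent h) \notin q ->
  forall u, last (inl h : witness) q = inl u -> u = h.
Proof.
move=> lh.
(* [star k] contains all that is reachable from [h] in [k] steps while avoiding the parent: [h]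
   itself and the inner vertices within distance [k] on its long edges. Up to four steps no far end
   is reached. *)
pose star k (z : witness) := match z with
  | inl u => u = h
  | inr (e, i) => (src e = h /\ i < k) \/ (tgt e = h /\ 4 <= i + k)
  end.
suff main k z : star k z -> path (@adj witness) z q -> size q + k <= 4 ->
    inl (parent h) \notin q -> star (size q + k) (last z q).
  move=> qP sq nq u lu; have := main 0 (inl h) (erefl _) qP.
  by rewrite addn0 lu; apply.
elim: q k z => [//|w q IHq] k z starz /=.
rewrite inE negb_or => /andP[zw qP] sq /andP[nw nq].
rewrite addSnnS; apply: (IHq _ w) => //; last by rewrite -addSnnS.
have k3 : k <= 3 by lia.
case: z starz zw => [u|[e i]]; case: w nw {qP} => [v|[e' i']] /=.
- by move=> nw -> /(short_leaf lh) vh; rewrite vh eqxx in nw.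
- by move=> _ -> /orP[/andP[/eqP -> /eqP ->]|/andP[/eqP -> /eqP ->]]; [left|right].
- move=> _ + /orP[/andP[/eqP -> /eqP i0]|/andP[/eqP -> /eqP i3]].
    by case=> [[-> _]//|[_]]; rewrite i0 add0n ltnNge k3.
  by case=> [[_]|[-> _]//]; rewrite i3 ltnNge k3.
- move=> _ + /andP[/eqP <- ii'].
  by case=> [[es lt]|[et le]]; [left|right]; split=> //; lia.
Qed.

Lemma root_walk h : exists w, [/\ path (@adj witness) (inl h) w,
  last (inl h : witness) w = inl Root & size w <= 2].
Proof.
have [->|h0] := eqVneq h Root; first by exists [::].
have up u : u != Root -> short u (parent u).
  by move=> u0; rewrite short_sym short_parent.
have [ph|ph] := eqVneq (parent h) Root.
  by exists [:: inl (parent h)]; split; rewrite //= ?up ?ph.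
exists [:: inl (parent h); inl Root]; split => //.
have pp : parent (parent h) = Root by case: (h) => [|?|? ?|[] ? ? ?].
by rewrite /= up // -pp up.
Qed.

(** * How a geodesic meets the vertices of the tree *)

Section Blocks.
Variables (x : witness) (p : seq witness).
Hypothesis geo : geodesic x p.
Local Notation s := (x :: p).

(** Otherwise the geodesic contains a child of [r] from each of the three classes of [k], and these
    are pairwise nonadjacent neighbours of [r]. *)
Lemma siblings_block r (k : hub -> 'I_3) : exists c : 'I_3, forall h,
  h != Root -> parent h = r -> k h = c -> (inl h : witness) \notin s.
Proof.
apply: contrapT => none.
have ex c : exists h, [/\ h != Root, parent h = r, k h = c & (inl h : witness) \in s].
  apply: contrapT => noh; apply: none; exists c => h h0 hr hk.
  by apply/negP => hs; apply: noh; exists h.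
have [u [u0 ur uk us]] := ex ord0.
have [v [v0 vr vk vs]] := ex (inord 1).
have [w [w0 wr wk ws]] := ex ord_max.
have nk c d : c != d :> 'I_3 -> forall a b, k a = c -> k b = d ->
    (inl a : witness) != inl b.
  by move=> cd a b ak bk; apply: contra_neq cd => -[ab]; rewrite -ak -bk ab.
apply: (geodesic_no_claw (a := inl r) geo us vs ws).
- by rewrite /= -ur short_parent.
- by rewrite /= -vr short_parent.
- by rewrite /= -wr short_parent.
- rewrite /= !inE !negb_or !andbT; apply/andP; split; first (apply/andP; split).
  + by apply: nk uk vk; rewrite -val_eqE /= inordK.
  + by apply: nk uk wk.
  + by apply: nk vk wk; rewrite -val_eqE /= inordK.
- by rewrite /= siblings_nadj // ur.
- by rewrite /= siblings_nadj // vr.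
- by rewrite /= siblings_nadj // ur.
Qed.

(** The tree joins the two hubs through the root in at most four steps, so the geodesic does so too;
    by [leaf_star] it cannot reach another hub that quickly while avoiding the parent. *)
Lemma leaf_block h h' : leaf h -> h != h' -> (inl h : witness) \in s ->
  (inl h' : witness) \in s -> (inl (parent h) : witness) \in s.
Proof.
move=> lh hh' hs hs'; apply/negPn/negP => ps.
have [w [wP wl sw]] := root_walk h; have [w' [wP' wl' sw']] := root_walk h'.
have [||q [qP ql sq qs]] := @geodesic_walk _ _ _ geo _ _ (w ++ rev (belast (inl h') w')) hs hs'.
- by rewrite cat_path wP wl -wl' (path_rev_belast wP').
- by rewrite last_cat wl -wl'; exact: last_rev_belast.
have := leaf_star lh qP _ _ ql; rewrite size_cat size_rev size_belast in sq.
move=> e; rewrite e ?eqxx // in hh'; first lia.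
by apply: contra ps => pq; move/allP: qs; apply.
Qed.

(** The geodesic contains a common neighbour of the two by [geodesic_gap2]. No long edge ends at a
    child of the root, and a hub has only one parent, so this neighbour is the root. *)
Lemma level1_block h h' : parent h = Root -> parent h' = Root -> h != Root ->
  h' != Root -> h != h' -> (inl h : witness) \in s -> (inl h' : witness) \in s ->
  (inl Root : witness) \in s.
Proof.
move=> ph ph' h0 h'0 hh' hs hs'.
have rh : short Root h by rewrite -{1}ph short_parent.
have rh' : short Root h' by rewrite -{1}ph' short_parent.
have [||_ [m [ms hm mh']]] :=
  @geodesic_gap2 _ _ _ geo (inl Root) (inl h) (inl h') hs hs' _ _ rh rh'.
- by apply: contra_neq hh' => -[].
- by rewrite /= siblings_nadj // ph.
case: m ms hm mh' => [u|[e k]] ms /=; last first.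
  have notend v : parent v = Root -> v != Root -> incident src tgt v e k -> False.
    move=> pv v0 /orP[]/andP[/eqP ve _]; move: pv v0; rewrite ve.
      by case: (e) => [? ? ?|[] ? ? ?|? ? ?].
    by case: (e) => [? ? ?|[] ? ? ?|? ? ?].
  by move=> /(notend _ ph h0).
have [<- //|u0] := eqVneq u Root.
move=> /andP[_ /orP[/eqP e|/eqP e]]; first by rewrite -e ph eqxx in u0.
move=> /andP[_ /orP[/eqP e'|/eqP e']]; last by rewrite -e' ph' eqxx in u0.
by rewrite -e -e' eqxx in hh'.
Qed.

End Blocks.

(** * The lower bound *)

(* The vertices 0, 1, 2 are p, q and b; 3 + l and 8 + l are the vertices x_l and
   y_l of the ladder. Loops are included, so that adjacency means touching. *)
Definition core_edges : seq (nat * nat) :=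
  [seq (a, a) | a <- iota 0 13] ++ [:: (0, 2); (1, 2); (2, 8); (2, 12)] ++
  flatten [seq [:: (0, 3 + l); (1, 8 + l); (3 + l, 8 + l)] | l <- iota 0 5] ++
  flatten [seq [:: (3 + l, 4 + l); (8 + l, 9 + l)] | l <- iota 0 4].

Definition core_adj : rel nat :=
  fun a b => ((a, b) \in core_edges) || ((b, a) \in core_edges).

(* The sets of five vertices that hit all crosses of a row with a column and all
   of the pairs {b, q}, {b, y_0}, {b, y_4} are the sets {p, q, b, x_j, y_k} and
   {p, q, y_0, y_4, x_j}; the last five members exclude these. *)
Definition core_bramble : seq (seq nat) :=
  flatten [seq [:: [:: 3 + l; 8 + l; 0]; [:: 3 + l; 8 + l; 1];
                   rcons (iota 3 5) (8 + l); rcons (iota 8 5) (3 + l)]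
          | l <- iota 0 5] ++
  [:: [:: 2; 1]; [:: 2; 8]; [:: 2; 12]; [:: 9; 10; 11];
      [:: 3; 8]; [:: 4; 9; 8]; [:: 4; 5; 6; 11; 12]; [:: 7; 12; 11; 10; 9]].

Lemma core_bramble_connected : all (connected_seq core_adj) core_bramble.
Proof. by vm_compute. Qed.

Lemma core_bramble_touching :
  all (fun s => all (touching_seq core_adj s) core_bramble) core_bramble.
Proof. by vm_compute. Qed.

(** A search over all hitting sets: some element of the first set must be chosen, which uses up one
    unit of [k] and discards the sets it hits. *)
Fixpoint unhittable (T : eqType) (k : nat) (B : seq (seq T)) : bool :=
  if B is s :: B' then
    if k is k'.+1 then
      all (fun a => unhittable k' [seq s' <- B' | a \notin s']) s
    else true
  else false.

Lemma unhittableP (T : eqType) k (B : seq (seq T)) (X : seq T) :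
  unhittable k B -> size X <= k -> ~~ all (has (mem X)) B.
Proof.
elim: k B X => [|k IHk] [|s B] X //=.
  by case: X => //= _ _; rewrite has_pred0.
move=> uns sX; apply/negP => /andP[hs hB].
have [a sa /= aX] := hasP hs.
have sr : size (rem a X) <= k by rewrite size_rem //; case: (X) aX sX.
have /negP := IHk _ _ (allP uns a sa) sr; apply; apply/allP => s'.
rewrite mem_filter => /andP[as' /(allP hB)/hasP[b bs' /= bX]].
apply/hasP; exists b => //=; move: bX; rewrite (perm_mem (perm_to_rem aX)).
by rewrite inE => /predU1P[ba|//]; rewrite -ba bs' in as'.
Qed.

Lemma core_bramble_order : unhittable 5 core_bramble.
Proof. by vm_compute. Qed.

Section Core.
Variables c i b : 'I_3.

(* Outside block [b] the leaves of [High c i] may lie in its part and are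
   unlabelled, while those of [Low c] are contracted into the root. *)
Definition core (h : hub) : option nat :=
  match h with
  | Root => Some 2
  | Low c' => if c' == c then Some 1 else None
  | High c' i' => if (c' == c) && (i' == i) then Some 0 else None
  | Leaf t c' i' j =>
      if (c' == c) && (i' == i) then
        if j %/ 5 == b then Some ((if t then 3 else 8) + j %% 5)
        else if t then None else Some 2
      else None
  end.

Definition upper (j : nat) : hub := Leaf true c i (inord j).
Definition lower (j : nat) : hub := Leaf false c i (inord j).

Local Notation joined := (joined short src tgt).

Lemma core_leaf t l : l < 5 ->
  core (Leaf t c i (inord (5 * b + l))) = Some ((if t then 3 else 8) + l).
Proof.
move=> l5; rewrite /core !eqxx /= inordK; last by case: (b) => /=; lia.
by rewrite mulnC divnMDl // divn_small // addn0 eqxx modnMDl modn_small.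
Qed.

Lemma core_lower_out j : j < 15 -> j %/ 5 != b -> core (lower j) = Some 2.
Proof. by move=> j15 jb; rewrite /= !eqxx /= inordK // (negbTE jb). Qed.

Lemma joined_lane t j : j < 14 ->
  joined (Leaf t c i (inord j)) (Leaf t c i (inord j.+1)).
Proof.
move=> j14; right; exists (Lane t c i (Ordinal j14)); left; split => /=.
  by congr Leaf; apply/val_inj; rewrite /= inordK // ltnW.
by congr Leaf; apply/val_inj; rewrite /= inordK.
Qed.

Lemma joined_closing (r : bool) : joined Root (lower (if r then 14 else 0)).
Proof.
right; exists (Closing r c i); left; split => //=.
by congr Leaf; apply/val_inj; case: r; rewrite /= inordK.
Qed.

Lemma core_edges_joined a a' : (a, a') \in core_edges -> exists h h',
  [/\ core h = Some a, core h' = Some a' & h = h' \/ joined h h'].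
Proof.
have leafH t l : l < 5 -> joined (if t then High c i else Low c)
    (Leaf t c i (inord (5 * b + l))).
  by move=> _; left; rewrite -[X in short X _]/(parent (Leaf t c i (inord (5 * b + l))));
    case: t; apply: short_parent.
rewrite /core_edges mem_cat => /orP[|].
  2: rewrite mem_cat => /orP[|].
  3: rewrite mem_cat => /orP[|].
- case/mapP => a0; rewrite mem_iota => /= a13 [-> ->] {a a'}.
  suff [h hP] : exists h, core h = Some a0 by exists h, h; split => //; left.
  have [a3|a3] := ltnP a0 3.
    case: a0 a3 {a13} => [|[|[|//]]] _.
    + by exists (High c i); rewrite /= !eqxx.
    + by exists (Low c); rewrite /= eqxx.
    + by exists Root.
  have [a8|a8] := ltnP a0 8.
    by exists (upper (5 * b + (a0 - 3))); rewrite core_leaf ?subnKC //; lia.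
  by exists (lower (5 * b + (a0 - 8))); rewrite core_leaf ?subnKC //; lia.
- rewrite !inE => /or4P[]/eqP[-> ->].
  + exists (High c i), Root; split; rewrite /= ?eqxx //; right; left.
    by rewrite short_sym -[Root]/(parent (High c i)) short_parent.
  + exists (Low c), Root; split; rewrite /= ?eqxx //; right; left.
    by rewrite short_sym -[Root]/(parent (Low c)) short_parent.
  (* Label 2 meets the first column of the block at the root if the block begins the row, and
     otherwise at the preceding lower leaf. The last column is treated symmetrically. *)
  + have [b0|b0] := eqVneq (b : nat) 0.
      exists Root, (lower (5 * b + 0)); split; rewrite ?core_leaf //; right.
      by rewrite b0; exact: (joined_closing false).
    exists (lower (5 * b).-1), (lower (5 * b + 0)).
    split; [by apply: core_lower_out; case: (b) b0 => /=; lia|exact: core_leaf|].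
    right; rewrite addn0 -[in X in joined _ X](@prednK (5 * b)); last lia.
    by apply: joined_lane; case: (b) b0 => /=; lia.
  + have [b2|b2] := eqVneq (b : nat) 2.
      exists Root, (lower (5 * b + 4)); split; rewrite ?core_leaf //; right.
      by rewrite b2; exact: (joined_closing true).
    exists (lower (5 * b + 5)), (lower (5 * b + 4)).
    split; [by apply: core_lower_out; case: (b) b2 => /=; lia|exact: core_leaf|].
    right; rewrite (_ : 5 * b + 5 = (5 * b + 4).+1); last lia.
    apply/(joined_sym short_sym)/joined_lane.
    by case: (b) b2 => /=; lia.
- move=> /flatten_mapP[l]; rewrite mem_iota => /= l5.
  rewrite !inE => /or3P[]/eqP[-> ->].
  + exists (High c i), (upper (5 * b + l)); split; rewrite ?core_leaf //= ?eqxx //.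
    by right; exact: (leafH true).
  + exists (Low c), (lower (5 * b + l)); split; rewrite ?core_leaf //= ?eqxx //.
    by right; exact: (leafH false).
  + exists (upper (5 * b + l)), (lower (5 * b + l)).
    split; rewrite ?core_leaf //; right; right.
    by exists (Rung c i (inord (5 * b + l))); left.
- move=> /flatten_mapP[l]; rewrite mem_iota => /= l4.
  have lane t : joined (Leaf t c i (inord (5 * b + l))) (Leaf t c i (inord (5 * b + l.+1))).
    by rewrite addnS; apply: joined_lane; case: (b) => /=; lia.
  rewrite !inE => /orP[]/eqP[-> ->].
  + exists (upper (5 * b + l)), (upper (5 * b + l.+1)).
    split; last by right; exact: lane.
      exact: (core_leaf true (ltnW l4)).
    by rewrite (@core_leaf true l.+1 l4) -?addSnnS.
  + exists (lower (5 * b + l)), (lower (5 * b + l.+1)).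
    split; last by right; exact: lane.
      exact: (core_leaf false (ltnW l4)).
    by rewrite (@core_leaf false l.+1 l4) -?addSnnS.
Qed.

(** Label 2 is excepted because the root shares it with the lower leaves outside the block. Within
    the block, quotient and remainder by 5 determine the column. *)
Lemma core_eq h h' a : core h = Some a -> core h' = Some a -> a != 2 -> h = h'.
Proof.
have colP (j j' : 'I_15) : j %/ 5 = b -> j' %/ 5 = b -> j %% 5 = j' %% 5 -> j = j'.
  by move=> jb j'b e; apply/val_inj; rewrite /= (divn_eq j 5) (divn_eq j' 5) jb j'b e.
have lt5 (j : 'I_15) : j %% 5 < 5 by rewrite ltn_mod.
have shape u : core u = Some a -> a != 2 -> match u with
    | Root => False
    | Low c' => c' = c /\ a = 1
    | High c' i' => [/\ c' = c, i' = i & a = 0]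
    | Leaf t c' i' j =>
        [/\ c' = c, i' = i, j %/ 5 = b & a = (if t then 3 else 8) + j %% 5]
    end.
  case: u => [|c'|c' i'|t c' i' j] /=.
  - by case=> <-.
  - by case: eqP => // -> [<-].
  - by case: eqP => //= ->; case: eqP => // -> [<-].
  - case: eqP => //= ->; case: eqP => //= ->; case: eqP => [jb [<-] //|_].
    by case: t => // -[<-].
move=> /shape + /shape + a2 => /(_ a2) + /(_ a2).
case: h => [|c1|c1 i1|t j1 i1 k1]; case: h' => [|c2|c2 i2|t' j2 i2 k2] //.
- by move=> [-> _] [-> _].
- by move=> [_ ->] [].
- by case: t' => -[_ ->] [].
- by move=> [_ _ ->] [].
- by move=> [-> -> _] [-> -> _].
- by case: t' => -[_ _ ->] [].
- by case: t => -[_ _ _ ->] [].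
- by case: t => -[_ _ _ ->] [].
move=> [-> -> k1b ->] [-> -> k2b e].
(* The labels of the two rows fill the disjoint ranges 3 to 7 and 8 to 12. *)
have /andP[/eqP -> /eqP ekk] : (t == t') && (k1 %% 5 == k2 %% 5).
  by move: e (lt5 k1) (lt5 k2); case: (t); case: (t') => /=; lia.
by rewrite (colP k1 k2).
Qed.

Section Labelled.
Variable P : {set {set witness}}.
Hypothesis geoP : geodesic_partition P.
Local Notation block z := (finset.pblock P (z : witness)).
Hypothesis root_block : forall h, h != Root -> parent h = Root ->
  (if h is Low c' then c' == c else if h is High c' _ then c' == c else false) ->
  inl h \notin block (inl Root).
Hypothesis low_block : forall j, inl (Leaf false c i j) \notin block (inl (Low c)).
Hypothesis high_block : forall j : 'I_15, j %/ 5 = b ->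
  inl (Leaf true c i j) \notin block (inl (High c i)).

Lemma block_geodesic A : A \in P -> exists x p, geodesic x p /\ A = [set z in x :: p]%SET.
Proof. exact: (proj2 geoP). Qed.

Lemma block_connected A : A \in P -> connected_in A.
Proof. by move=> /block_geodesic[x [p [geo ->]]]; exact: geodesic_connected. Qed.

Lemma in_block A z : A \in P -> z \in A -> block z = A.
Proof. by have [/and3P[_ tP _] _] := geoP; exact: def_pblock. Qed.

(** A core leaf sharing its part with another hub would bring its parent along, contrary to
    [low_block] or [high_block]. Two core hubs that are not leaves force the root into the part,
    contrary to [root_block]. *)
Lemma core_block_inj A h h' : A \in P -> core h -> core h' ->
  inl h \in A -> inl h' \in A -> h = h'.
Proof.
move=> AP ch ch' hA hA'; apply/eqP/negPn/negP => nhh'.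
have [x [p [geo defA]]] := block_geodesic AP.
have inA (z : witness) : (z \in A) = (z \in x :: p) by rewrite defA finset.in_set.
have noleaf u v : core u -> u != v -> inl u \in A -> inl v \in A -> ~~ leaf u.
  move=> cu uv uA vA; apply/negP => lu.
  have pA : inl (parent u) \in A by rewrite inA (leaf_block geo lu uv) -?inA.
  case: u cu uv uA lu pA => // t c' i' j /=.
  case: eqP => //= ->; case: eqP => //= -> + _ uA _ pA.
  case: t uA pA => uA pA; last first.
    by move: (low_block j); rewrite (in_block AP pA) uA.
  case: eqP => // jb _.
  by move: (high_block jb); rewrite (in_block AP pA) uA.
have rootA u : core u -> u != Root -> ~~ leaf u -> inl u \in A -> inl Root \in A -> False.
  move=> cu u0 lu uA rA; move: (in_block AP rA) => eA.
  have := root_block u0; rewrite eA uA.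
  by case: u u0 cu lu {uA} => //= [c'|c' i'] _; case: eqP => //= _ _ _ /(_ erefl erefl).
have lh := noleaf _ _ ch nhh' hA hA'.
have lh' : ~~ leaf h' by apply: noleaf ch' _ hA' hA; rewrite eq_sym.
have [h0|h0] := eqVneq h Root.
  by apply: (rootA h') => //; [rewrite eq_sym -h0|rewrite -h0].
have [h'0|h'0] := eqVneq h' Root.
  by apply: (rootA h) => //; rewrite -h'0.
apply: (rootA h) => //; rewrite inA.
by apply: (level1_block geo _ _ h0 h'0 nhh'); rewrite -?inA //;
  [case: (h) lh|case: (h') lh'].
Qed.

Local Notation lab := (label core P).

Lemma core_fiber_touching a a' : core_adj a a' -> touching (fiber lab a) (fiber lab a').
Proof.
have aux a1 a2 : (a1, a2) \in core_edges -> touching (fiber lab a1) (fiber lab a2).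
  move=> /core_edges_joined[h [h' [ch ch' [e|hh']]]].
    exists (inl h), (inl h); split; last by left.
      by rewrite inE (label_core (proj1 geoP) core_block_inj) ch.
    by rewrite inE e (label_core (proj1 geoP) core_block_inj) ch'.
  exact: joined_touching (proj1 geoP) block_connected core_block_inj _ _ _ _ hh' ch ch'.
case/orP; first exact: aux.
move=> /aux[x [y [xS yS xy]]]; exists y, x; split=> //.
by case: xy => [->|xy]; [left|right; rewrite adj_sym].
Qed.

(** Only label 2 has several core hubs. A lower leaf outside the block reaches the root by following
    its row away from the block and taking the closing edge there. *)
Lemma core_fiber_connected a : connected_in (fiber lab a).
Proof.
set e := [rel z w | [&& z \in fiber lab a, w \in fiber lab a & adj z w]].
have esym : symmetric e.
  by move=> x y; rewrite /e /= (sub_adj_sym src tgt short_sym) andbCA.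
have step h h' : joined h h' -> core h = Some a -> core h' = Some a ->
    connect e (inl h) (inl h').
  exact: joined_connect (proj1 geoP) block_connected core_block_inj _ _ _.
suff hubs h h' : core h = Some a -> core h' = Some a -> connect e (inl h) (inl h').
  move=> z w za wa.
  have toc := fiber_to_core (proj1 geoP) block_connected core_block_inj src_tgt.
  have [h ch zh] := toc _ _ za; have [h' ch' wh'] := toc _ _ wa.
  apply: connect_trans zh _; apply: connect_trans (hubs _ _ ch ch') _.
  by rewrite (sym_connect_sym esym).
have [a2|a2] := eqVneq a 2; last first.
  by move=> ch ch'; rewrite (core_eq ch ch' a2) connect0.
rewrite {}a2 in e esym step *.
suff toroot u : core u = Some 2 -> connect e (inl u) (inl Root).
  move=> ch ch'; apply: connect_trans (toroot _ ch) _.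
  by rewrite (sym_connect_sym esym) toroot.
case: u => [_|c'|c' i'|t c' i' j] /=.
- exact: connect0.
- by case: ifP.
- by case: ifP.
case: eqP => //= ->; case: eqP => //= ->.
case: eqP => [_|jb]; first by case: t; case.
case: t => // _.
have down n : n < 15 -> n %/ 5 < b -> connect e (inl (lower n)) (inl Root).
  elim: n => [|n IHn] n15 nb.
    apply: step => //; first exact/(joined_sym short_sym)/(joined_closing false).
    by apply: core_lower_out; rewrite // ltn_eqF.
  have nb' : n %/ 5 < b by apply: leq_ltn_trans nb; apply: leq_div2r.
  apply: connect_trans (IHn (ltnW n15) nb'); apply: step.
  - exact/(joined_sym short_sym)/joined_lane.
  - by apply: core_lower_out; rewrite // ltn_eqF.
  - by apply: core_lower_out; rewrite ?ltn_eqF // ltnW.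
(* To the right of the block the induction runs over the distance [k] to the last column. *)
have up k : k < 15 -> b < (14 - k) %/ 5 -> connect e (inl (lower (14 - k))) (inl Root).
  elim: k => [|k IHk] k15 kb.
    apply: step => //; first exact/(joined_sym short_sym)/(joined_closing true).
    by apply: core_lower_out; rewrite // gtn_eqF.
  have kS : 14 - k = (14 - k.+1).+1 by rewrite subnSK.
  have kb' : b < (14 - k) %/ 5.
    by apply: leq_trans kb _; apply: leq_div2r; rewrite kS.
  apply: connect_trans (IHk (ltnW k15) kb'); apply: step.
  - by rewrite kS; apply: joined_lane; rewrite -kS leq_subr.
  - by apply: core_lower_out; rewrite ?gtn_eqF // ltnS leq_subr.
  - by apply: core_lower_out; rewrite ?gtn_eqF // ltnS leq_subr.
have -> : Leaf false c i j = lower j by rewrite /lower inord_val.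
have [jb'|jb'|jb'] := ltngtP (j %/ 5) b; last by rewrite jb' in jb.
  exact: down.
by rewrite -(subKn (ltn_ord j : j <= 14)); apply: up; rewrite ?subKn ?ltnS ?leq_subr // -ltnS.
Qed.

Lemma core_hitting (D : sgraph) (bag : D -> {set quotient_graph P}) :
  tree_decomposition bag -> exists t, 5 < #|bag t|.
Proof.
move=> decD; apply: contrapT => small.
have [|X X5 hit] := quotient_hitting core_fiber_connected core_fiber_touching
  (label_block (proj1 geoP) block_connected core_block_inj) (proj1 geoP) decD _
  (isT : core_bramble != [::]) core_bramble_connected core_bramble_touching (k := 5).
  by move=> t; rewrite leqNgt; apply/negP => t5; apply: small; exists t.
by have := unhittableP core_bramble_order X5; rewrite hit.
Qed.
End Labelled.

End Core.

Lemma witness_lower : 5 <= geodesic_treewidth witness.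
Proof.
rewrite /geodesic_treewidth; case: ex_minnP => k /asboolP[P [geoP <-]] _.
rewrite /treewidth; case: ex_minnP => w /asboolP[D [bag [decD <-]]] _.
have avoid r (f : hub -> 'I_3) : exists c : 'I_3, forall h, h != Root ->
    parent h = r -> f h = c -> (inl h : witness) \notin finset.pblock P (inl r).
  have [bP _] := block_pblock (proj1 geoP) (inl r).
  have [x [p [geo defA]]] := proj2 geoP _ bP.
  have [c cP] := siblings_block geo r f; exists c => h h0 hr hc.
  by rewrite defA finset.in_set; exact: cP.
(* The choices are made in turn, [i] depending on [c], and [b] on both. Putting [Low c] and all
   [High c i] in one class makes a single [c] miss all of them; [ord0] is a dummy for hubs that are
   not children of the vertex in question. *)
have [c cP] := avoid Root (fun h => if h is Low c' then c' else
                                    if h is High c' _ then c' else ord0).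
have [i iP] := avoid (Low c) (fun h => if h is Leaf _ _ i' _ then i' else ord0).
have [b bP] := avoid (High c i)
  (fun h => if h is Leaf _ _ _ j then inord (j %/ 5) else ord0).
have [|j|j jb|t t5] := @core_hitting c i b P geoP _ _ _ D bag decD.
- move=> h h0 hR hc; apply: cP => //.
  by case: h {h0 hR} hc => // [c'|c' i'] /eqP.
- exact: iP.
- by apply: bP => //=; apply/val_inj; rewrite /= inordK jb.
by rewrite /width ltn_predRL; apply: leq_trans t5 (leq_bigmax _).
Qed.

(** * Straight-line drawings *)

Import Order.TTheory GRing.Theory Num.Theory numFieldNormedType.Exports.
Local Open Scope ring_scope.

Section StraightDrawing.
Variable R : realType.

Definition segment (a b : R * R) (t : R) : R * R :=
  (a.1 + t * (b.1 - a.1), a.2 + t * (b.2 - a.2)).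

Lemma segment_inj a b s t : a != b -> segment a b s = segment a b t -> s = t.
Proof.
move=> ab [/addrI e1 /addrI e2]; apply/eqP/negPn/negP => st.
move: ab; rewrite -pair_eqE /= negb_and => /orP[]; rewrite eq_sym -subr_eq0.
  by move=> /mulIf inj; move: st; rewrite (inj _ _ e1) eqxx.
by move=> /mulIf inj; move: st; rewrite (inj _ _ e2) eqxx.
Qed.

Lemma segment0 a b : segment a b 0 = a.
Proof. by case: a => a1 a2; rewrite /segment !mul0r !addr0. Qed.

Lemma segment1 a b : segment a b 1 = b.
Proof. by case: a b => a1 a2 [b1 b2]; rewrite /segment !mul1r /= !subrKC. Qed.

Lemma segment_segment a b s t u :
  segment (segment a b s) (segment a b t) u = segment a b (s + u * (t - s)).
Proof. by rewrite /segment /=; congr pair; ring. Qed.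

Lemma segmentC a b t : segment a b t = segment b a (1 - t).
Proof. by rewrite /segment; congr pair; ring. Qed.

Lemma segment_continuous a b : continuous (segment a b).
Proof.
have coord (c d : R) : continuous (fun t : R => c + t * d).
  by move=> t; apply: cvgD; [exact: cvg_cst|apply: cvgM; [exact: cvg_id|exact: cvg_cst]].
move=> t; exact: (cvg_pair (coord a.1 (b.1 - a.1) t) (coord a.2 (b.2 - a.2) t)).
Qed.

Variables (G : sgraph) (pos : G -> R * R).
Hypothesis pos_inj : injective pos.
Hypothesis pos_off : forall u v w (t : R), adj u v -> t \in `]0, 1[%R ->
  segment (pos u) (pos v) t <> pos w.
Hypothesis seg_off : forall u v u' v' (s t : R), adj u v -> adj u' v' ->
  [set u; v]%SET != [set u'; v']%SET -> s \in `]0, 1[%R -> t \in `]0, 1[%R ->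
  segment (pos u) (pos v) s <> segment (pos u') (pos v') t.

(** [pick] fixes one of the two orientations of an edge; the constant arc only occurs for sets that
    are not edges. *)
Definition straight_arc (E : {set G}) : R -> R * R :=
  if [pick p : G * G | adj p.1 p.2 && (E == [set p.1; p.2]%SET)] is Some p
  then segment (pos p.1) (pos p.2) else fun=> 0.

Lemma straight_planar : planar R G.
Proof.
exists pos, straight_arc; split=> //.
have arcP E : E \in edges G -> exists u v,
    [/\ adj u v, E = [set u; v]%SET & straight_arc E = segment (pos u) (pos v)].
  move=> /imsetP[p0]; rewrite inE => adjp0 E0; rewrite /straight_arc.
  case: pickP => [p /andP[adjp /eqP Ep]|/(_ p0)]; last by rewrite adjp0 E0 eqxx.
  by exists p.1, p.2.
split=> [E /arcP[u [v [uv EE ->]]]|E F /arcP[u [v [uv -> ->]]]]; last first.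
  move=> /arcP[u' [v' [uv' -> ->]]] neq s t s01 t01; exact: seg_off.
have nuv : u != v by apply: contraTneq uv => ->; rewrite adj_irrefl.
split.
- by apply: continuous_subspaceT; exact: segment_continuous.
- by move=> s t _ _; apply: segment_inj; apply: contra_neq nuv => /pos_inj.
- rewrite EE; apply/seteqP; split=> [_ [t [->|->] <-]|_ [w /= + <-]].
  + by exists u; [rewrite /= !inE eqxx|rewrite segment0].
  + by exists v; [rewrite /= !inE eqxx orbT|rewrite segment1].
  rewrite !inE => /orP[]/eqP->.
  + by exists 0; [left|rewrite segment0].
  + by exists 1; [right|rewrite segment1].
- by move=> t w t01; exact: pos_off.
Qed.

End StraightDrawing.

(** * Subdividing a straight-line drawing *)

Section SubdividedDrawing.
Variables (R : realType) (H E : finType) (short : rel H) (src tgt : E -> H).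
Hypotheses (short_sym : symmetric short) (short_irr : irreflexive short).
Variable place : H -> R * R.

Definition drawn (u v : H) : Prop := short u v \/ exists e, src e = u /\ tgt e = v.

Hypothesis place_inj : injective place.
Hypothesis long_inj : forall e e',
  [set src e; tgt e]%SET = [set src e'; tgt e']%SET -> e = e'.
Hypothesis long_short : forall e u v, short u v ->
  [set u; v]%SET != [set src e; tgt e]%SET.
Hypothesis place_off : forall u v w (t : R), drawn u v -> t \in `]0, 1[%R ->
  segment (place u) (place v) t <> place w.
Hypothesis place_seg_off : forall u v u' v' (s t : R), drawn u v -> drawn u' v' ->
  [set u; v]%SET != [set u'; v']%SET -> s \in `]0, 1[%R -> t \in `]0, 1[%R ->
  segment (place u) (place v) s <> segment (place u') (place v') t.
Hypothesis src_tgt : forall e, src e != tgt e.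

Local Notation G := (subdivision src tgt short_sym short_irr).
Local Notation long_segment e := (segment (place (src e)) (place (tgt e))).

Definition sub_place (z : G) : R * R :=
  match z with
  | inl h => place h
  | inr (e, k) => long_segment e (k.+1%:R / 5)
  end.

(** Numbers the vertices of a long edge from 0 to 5; index 5 is the target because 4 is not in
    ['I_4]. *)
Definition long_vertex (e : E) (i : nat) : G :=
  match i with
  | 0 => inl (src e)
  | j.+1 => if insub j is Some k then inr (e, k) else inl (tgt e)
  end.

Lemma sub_place_long (e : E) (i : nat) : (i <= 5)%N ->
  sub_place (long_vertex e i) = long_segment e (i%:R / 5).
Proof.
case: i => [|j] /= j5; first by rewrite mul0r segment0.
case: insubP => [k _ <- //|]; rewrite -leqNgt => j4 /=.
have -> : j.+1 = 5 by apply/eqP; rewrite eqn_leq j5.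
by rewrite divff ?segment1 // pnatr_eq0.
Qed.

Lemma sub_adj_cases (z w : G) : adj z w ->
  (exists u v, [/\ short u v, z = inl u & w = inl v]) \/
  (exists e i, (i < 5)%N /\
    ((z = long_vertex e i /\ w = long_vertex e i.+1) \/
     (w = long_vertex e i /\ z = long_vertex e i.+1))).
Proof.
have ends u e k : incident src tgt u e k -> exists i, (i < 5)%N /\
    (((inl u : G) = long_vertex e i /\ inr (e, k) = long_vertex e i.+1) \/
     (inr (e, k) = long_vertex e i /\ (inl u : G) = long_vertex e i.+1)).
  case/orP=> /andP[/eqP-> /eqP k0].
    exists 0; split=> //; left; split=> //=.
    by case: insubP => [k' _ k'0|//]; congr (inr (_, _)); apply/ord_inj; rewrite k0 k'0.
  exists 4; split=> //; right; split=> /=; last by case: insubP.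
  by case: insubP => [k' _ k'3|//]; congr (inr (_, _)); apply/ord_inj; rewrite k0 k'3.
have inner e (k k' : 'I_4) : k.+1 = k' :> nat -> exists i, (i < 5)%N /\
    ((inr (e, k) : G) = long_vertex e i /\ inr (e, k') = long_vertex e i.+1).
  move=> kk'; exists k.+1; split; first by rewrite ltnS; exact: leq_trans (ltn_ord k) _.
  by rewrite /long_vertex valK kk' valK.
case: z w => [u|[e k]] [v|[e' k']] /=.
- by left; exists u, v.
- by move=> /ends[i [i5 h]]; right; exists e', i.
- by move=> /ends[i [i5 h]]; right; exists e, i; split=> //; case: h => -[]; [right|left].
- move=> /andP[/eqP <- /orP[]/eqP /(inner e)[i [i5 [h h']]]]; right; exists e, i; split=> //.
    by left.
  by right.
Qed.

(** Reduces crossings to the drawing before subdivision: the pieces of a long segment occupy its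
    successive open fifths. *)
Lemma edge_point (z w : G) (t : R) : adj z w -> t \in `]0, 1[%R ->
  (exists u v, [/\ short u v, z = inl u, w = inl v &
     segment (sub_place z) (sub_place w) t = segment (place u) (place v) t]) \/
  (exists e i s, [/\ [set z; w]%SET = [set long_vertex e i; long_vertex e i.+1]%SET,
     (i < 5)%N, (i%:R / 5 < s < i.+1%:R / 5) &
     segment (sub_place z) (sub_place w) t = long_segment e s]).
Proof.
move=> /sub_adj_cases[[u [v [uv -> ->]]]|[e [i [i5 zw]]]] t01.
  by left; exists u, v.
right; exists e, i.
have main (s : R) : s \in `]0, 1[%R -> exists r : R, (i%:R / 5 < r < i.+1%:R / 5) /\
   segment (sub_place (long_vertex e i)) (sub_place (long_vertex e i.+1)) s
     = long_segment e r.
  rewrite in_itv /= => /andP[s0 s1].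
  exists (i%:R / 5 + s * (i.+1%:R / 5 - i%:R / 5)); split.
    by rewrite -(natr1 i); apply/andP; split; lra.
  by rewrite (sub_place_long e (ltnW i5)) (sub_place_long e i5) segment_segment.
case: zw => [[-> ->]|[-> ->]].
  by have [r [r1 r2]] := main t t01; exists r.
have [|r [r1 r2]] := main (1 - t).
  by move: t01; rewrite !in_itv /= => /andP[t0 t1]; apply/andP; split; lra.
exists r; split => //; first by rewrite finset.setUC.
by rewrite segmentC.
Qed.

Lemma subdivision_planar : planar R G.
Proof.
have in01 (i : nat) (s : R) : (i < 5)%N -> i%:R / 5 < s < i.+1%:R / 5 -> s \in `]0, 1[%R.
  move=> i5 /andP[si is_]; rewrite in_itv /=; apply/andP; split.
    by apply: le_lt_trans si; rewrite divr_ge0.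
  by apply: lt_le_trans is_ _; rewrite ler_pdivrMr // mul1r ler_nat.
have k01 (k : 'I_4) : (k.+1%:R / 5 : R) \in `]0, 1[%R.
  rewrite in_itv /= divr_gt0 //= ltr_pdivrMr // mul1r ltr_nat.
  by rewrite ltnS ltn_ord.
have long_drawn e : drawn (src e) (tgt e) by right; exists e.
have long_neq e e' : e != e' -> [set src e; tgt e]%SET != [set src e'; tgt e']%SET.
  by apply: contra_neq; exact: long_inj.
have endsneq e : place (src e) != place (tgt e).
  by apply: contra_neq (src_tgt e) => /place_inj.
apply: (straight_planar (pos := sub_place)).
- move=> [u|[e k]] [v|[e' k']] /=.
  + by move=> /place_inj ->.
  + by move=> eu; case: (place_off (w := u) (long_drawn e') (k01 k')).
  + by case/(place_off (long_drawn e) (k01 k)).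
  have [->|ee'] := eqVneq e e'; last first.
    by case/(place_seg_off (long_drawn e) (long_drawn e') (long_neq _ _ ee') (k01 k) (k01 k')).
  move=> /(segment_inj (endsneq e')) kk'; congr (inr (_, _)); apply/ord_inj/eqP.
  by rewrite -eqSS -(eqr_nat R); apply/eqP/(mulIf _ kk'); rewrite invr_eq0 pnatr_eq0.
- move=> z w v t zw t01; case: (edge_point zw t01) => [[u [u' [uu' _ _ ->]]]|].
    case: v => [v|[e k]] /=; first by apply: place_off => //; left.
    by apply: place_seg_off (long_short e uu') t01 (k01 k) => //; left.
  move=> [e [i [s [_ i5 si ->]]]]; have s01 := in01 i s i5 si.
  case: v => [v|[e' k]] /=; first exact: place_off.
  have [<-|ee'] := eqVneq e e'; last exact: place_seg_off (long_neq _ _ ee') s01 (k01 k).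
  move=> /(segment_inj (endsneq e)) sk; move: si; rewrite sk.
  rewrite !ltr_pM2r ?invr_gt0 // !ltr_nat => /andP[ik ki].
  by move: (leq_trans ki ik); rewrite ltnn.
- move=> z w z' w' s t zw zw' neq s01 t01.
  case: (edge_point zw s01) => [[u [v [uv zu wv ->]]]|[e [i [a [zwE i5 ai ->]]]]];
    case: (edge_point zw' t01) => [[u' [v' [uv' zu' wv' ->]]]|[e' [i' [a' [zwE' i5' ai' ->]]]]].
  + apply: place_seg_off => //; [by left|by left|].
    apply: contra_neq neq => uvE; rewrite zu wv zu' wv'.
    have := congr1 (fun S : {set H} => ((inl : H -> G) @: S)%SET) uvE.
    by rewrite !imsetU !imset_set1.
  + apply: place_seg_off (long_short e' uv) s01 (in01 _ _ i5' ai') => //; by left.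
  + move=> /esym; apply: place_seg_off (long_short e uv') t01 (in01 _ _ i5 ai) => //; by left.
  have [ee'|ee'] := eqVneq e e'; last first.
    exact: place_seg_off (long_neq _ _ ee') (in01 _ _ i5 ai) (in01 _ _ i5' ai').
  rewrite -{}ee' in zwE' *; move=> /(segment_inj (endsneq e)) aa'.
  have ii' : i != i' by apply: contra_neq neq => ii'; rewrite zwE zwE' ii'.
  move: ai ai'; rewrite -aa' => /andP[a1 a2] /andP[a3 a4].
  have := lt_trans a1 a4; have := lt_trans a3 a2.
  rewrite !ltr_pM2r ?invr_gt0 // !ltr_nat !ltnS => h1 h2.
  by move: ii'; rewrite eqn_leq h1 h2.
Qed.

End SubdividedDrawing.

(** * Integer tests for points and segments *)

Local Open Scope Z_scope.

(** Twice the signed area of the triangle, zero for collinear points. *)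
Definition orient (a b c : Z * Z) : Z :=
  (b.1 - a.1) * (c.2 - a.2) - (b.2 - a.2) * (c.1 - a.1).

(** One of [c] and [d] may lie on the line through [a] and [b], so that segments with a common end
    can pass the test. *)
Definition one_side (a b c d : Z * Z) : bool :=
  let s := orient a b c in let t := orient a b d in
  [&& 0 <=? s, 0 <=? t & 0 <? s + t] || [&& s <=? 0, t <=? 0 & s + t <? 0].

Definition left_of (a b c d : Z * Z) : bool :=
  [&& a.1 <? c.1, a.1 <? d.1, b.1 <? c.1 & b.1 <? d.1].

(* [if] rather than a disjunction, which [vm_compute] would evaluate eagerly. *)
Definition apart (a b c d : Z * Z) : bool :=
  if left_of a b c d then true else if left_of c d a b then true else
  if one_side a b c d then true else one_side c d a b.

(** For collinear points, a positive scalar product of the vectors from [c] to [a] and [b] places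
    [c] outside the segment. *)
Definition off_line (a b c : Z * Z) : bool :=
  ~~ (orient a b c =? 0) ||
  (0 <? (a.1 - c.1) * (b.1 - c.1) + (a.2 - c.2) * (b.2 - c.2)).

Local Close Scope Z_scope.
Local Open Scope ring_scope.

Section RealPlane.
Variable R : realType.

Definition Zreal (z : Z) : R := (int_of_Z z)%:~R.

Lemma ZrealB a b : Zreal (Z.sub a b) = Zreal a - Zreal b.
Proof. by rewrite /Zreal -intrB -rmorphB. Qed.

Lemma ZrealD a b : Zreal (Z.add a b) = Zreal a + Zreal b.
Proof. by rewrite /Zreal -intrD -rmorphD. Qed.

Lemma ZrealM a b : Zreal (Z.mul a b) = Zreal a * Zreal b.
Proof. by rewrite /Zreal -intrM -rmorphM. Qed.

Lemma Zreal_ge0 a : Z.leb 0 a -> 0 <= Zreal a.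
Proof. by move=> a0; rewrite /Zreal ler0z; lia. Qed.

Lemma Zreal_gt0 a : Z.ltb 0 a -> 0 < Zreal a.
Proof. by move=> a0; rewrite /Zreal ltr0z; lia. Qed.

Lemma Zreal_inj : injective Zreal.
Proof. by move=> a b /intr_inj; exact: (can_inj int_of_ZK). Qed.

Definition real_point (a : Z * Z) : R * R := (Zreal a.1, Zreal a.2).

Definition orientR (a b c : R * R) : R :=
  (b.1 - a.1) * (c.2 - a.2) - (b.2 - a.2) * (c.1 - a.1).

Lemma orient_real a b c :
  orientR (real_point a) (real_point b) (real_point c) = Zreal (orient a b c).
Proof. by rewrite /orientR /orient /= !(ZrealB, ZrealM). Qed.

Lemma orient_segment a b c d t :
  orientR a b (segment c d t) = (1 - t) * orientR a b c + t * orientR a b d.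
Proof. by rewrite /orientR /segment /=; ring. Qed.

Lemma orient_line a b t : orientR a b (segment a b t) = 0.
Proof. by rewrite /orientR /segment /=; ring. Qed.

Lemma convex_gt0 (x y t : R) : 0 <= x -> 0 <= y -> 0 < x + y -> 0 < t -> t < 1 ->
  0 < (1 - t) * x + t * y.
Proof.
move=> x0 y0 xy t0 t1; have [x1|x1] := ltP 0 x.
  by rewrite ltr_pwDl ?mulr_gt0 ?subr_gt0 // mulr_ge0 // ltW.
have xe : x = 0 by apply/eqP; rewrite eq_le x1.
by move: xy; rewrite xe mulr0 !add0r => y1; rewrite mulr_gt0.
Qed.

(** The orientation with respect to the line of [a] and [b] is affine along the other segment and
    has strict sign in its interior, whereas it vanishes on the line. *)
Lemma one_side_disjoint a b c d (s t : R) : one_side a b c d -> t \in `]0, 1[%R ->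
  segment (real_point a) (real_point b) s <> segment (real_point c) (real_point d) t.
Proof.
move=> side; rewrite in_itv /= => /andP[t0 t1] e.
have := orient_line (real_point a) (real_point b) s.
rewrite e orient_segment !orient_real.
move: side; rewrite /one_side; move: (orient a b c) (orient a b d) => x y.
case/orP=> /and3P[x0 y0 xy].
  move: (Zreal_ge0 x0) (Zreal_ge0 y0) (Zreal_gt0 xy); rewrite ZrealD => X Y XY e0.
  by have := convex_gt0 X Y XY t0 t1; rewrite e0 ltxx.
have X : 0 <= - Zreal x by rewrite -sub0r -(ZrealB Z0); apply: Zreal_ge0; lia.
have Y : 0 <= - Zreal y by rewrite -sub0r -(ZrealB Z0); apply: Zreal_ge0; lia.
have XY : 0 < - Zreal x + - Zreal y.
  by rewrite -opprD -ZrealD -sub0r -(ZrealB Z0); apply: Zreal_gt0; lia.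
move=> e0; have := convex_gt0 X Y XY t0 t1.
by rewrite !mulrN -opprD e0 oppr0 ltxx.
Qed.

Lemma left_of_disjoint a b c d (s t : R) : left_of a b c d ->
  s \in `]0, 1[%R -> t \in `]0, 1[%R ->
  segment (real_point a) (real_point b) s <> segment (real_point c) (real_point d) t.
Proof.
move=> /and4P[ac ad bc bd]; rewrite !in_itv /= => /andP[s0 s1] /andP[t0 t1] [e _].
have lt x y : Z.ltb x y -> 0 < Zreal y - Zreal x.
  by move=> xy; rewrite -ZrealB; apply: Zreal_gt0; lia.
have convex (x y r : R) : 0 < x -> 0 < y -> 0 < r -> r < 1 -> 0 < (1 - r) * x + r * y.
  by move=> x0 y0 r0 r1; apply: convex_gt0 => //; rewrite ?addr_gt0 // ltW.
(* The difference of the first coordinates is a convex combination of the four positive differences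
   between ends. *)
have := convex _ _ t (convex _ _ s (lt _ _ ac) (lt _ _ bc) s0 s1)
  (convex _ _ s (lt _ _ ad) (lt _ _ bd) s0 s1) t0 t1.
rewrite [X in 0 < X](_ : _ = (Zreal c.1 + t * (Zreal d.1 - Zreal c.1)) -
  (Zreal a.1 + s * (Zreal b.1 - Zreal a.1))); last by ring.
by rewrite e subrr ltxx.
Qed.

Lemma apart_disjoint a b c d (s t : R) : apart a b c d ->
  s \in `]0, 1[%R -> t \in `]0, 1[%R ->
  segment (real_point a) (real_point b) s <> segment (real_point c) (real_point d) t.
Proof.
rewrite /apart => + s01 t01; case: ifP => [lft _|_].
  exact: left_of_disjoint lft s01 t01.
case: ifP => [lft _ /esym|_]; first exact: left_of_disjoint lft t01 s01.
case: ifP => [side _|_ side]; first exact: one_side_disjoint side t01.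
by move=> /esym; exact: one_side_disjoint side s01.
Qed.

Lemma off_line_segment a b c (t : R) : off_line a b c -> t \in `]0, 1[%R ->
  segment (real_point a) (real_point b) t <> real_point c.
Proof.
rewrite in_itv /= => off /andP[t0 t1] e.
case/orP: off => [/negP|dot].
  have := orient_line (real_point a) (real_point b) t.
  rewrite e orient_real => /(@Zreal_inj _ Z0) ->; exact.
have := Zreal_gt0 dot; rewrite ZrealD !ZrealM !ZrealB.
case: e => <- <-; rewrite /real_point /=; move: (Zreal a.1) (Zreal b.1) (Zreal a.2) (Zreal b.2).
move=> x y z w.
(* At the point with parameter [t] the scalar product is [- t (1 - t)] times the squared length,
   hence not positive. *)
rewrite [X in 0 < X](_ : _ = - (t * (1 - t)) * ((y - x) ^+ 2 + (w - z) ^+ 2)); last by ring.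
rewrite mulNr oppr_gt0 => /lt_geF; rewrite mulr_ge0 ?addr_ge0 ?sqr_ge0 //.
by rewrite mulr_ge0 ?subr_ge0 // ltW.
Qed.

End RealPlane.

(** * The drawing of the graph *)

(* Hubs named by numbers, so that statements about all of them can be decided
   by evaluation: kind 0 is the root, 1 [Low], 2 [High], 3 and 4 the leaves. *)
Definition code : Type := (nat * nat * nat * nat)%type.

Definition hub_name (h : hub) : code :=
  match h with
  | Root => (0, 0, 0, 0)
  | Low c => (1, c : nat, 0, 0)
  | High c i => (2, c : nat, i : nat, 0)
  | Leaf t c i j => (if t then 3 else 4, c : nat, i : nat, j : nat)
  end%N.

Lemma hub_name_inj : injective hub_name.
Proof.
move=> [|c|c i|[] c i j] [|c'|c' i'|[] c' i' j'] //=.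
- by case=> /ord_inj ->.
- by case=> /ord_inj -> /ord_inj ->.
- by case=> /ord_inj -> /ord_inj -> /ord_inj ->.
- by case=> /ord_inj -> /ord_inj -> /ord_inj ->.
Qed.

Local Open Scope Z_scope.

(* The root lies so high above the rest of the drawing that its edges are
   nearly vertical. The two rows of leaves are slightly curved in order that no
   two lanes are collinear. *)
Definition position (h : code) : Z * Z :=
  let: (k, c, i, j) := h in
  let c := Z.of_nat c in let i := Z.of_nat i in let j := Z.of_nat j in
  let x := 100 * (4 * c + i + 1) in
  match k with
  | O => (0, 100000)
  | S O => (400 * c + 50, 0)
  | S (S O) => (x + 29, 3600)
  | S (S (S O)) => (x + 3 * j + 7, 3300 + j * j)
  | _ => (x + 4 * j, 3000 + j * j)
  end.

Local Close Scope Z_scope.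

(** * Verification of the coordinates by evaluation *)

Local Open Scope nat_scope.

Definition all_hubs (Q : pred code) : bool :=
  Q (0, 0, 0, 0) &&
  all (fun c => Q (1, c, 0, 0) &&
    all (fun i => Q (2, c, i, 0) &&
      all (fun j => Q (3, c, i, j) && Q (4, c, i, j)) (iota 0 15))
    (iota 0 3)) (iota 0 3).

(** Every edge is listed in one orientation only, from parent to child or from source to target. *)
Definition all_edges (Q : rel code) : bool :=
  all (fun c => Q (0, 0, 0, 0) (1, c, 0, 0) &&
    all (fun i =>
      [&& Q (0, 0, 0, 0) (2, c, i, 0),
          Q (0, 0, 0, 0) (4, c, i, 0),
          Q (0, 0, 0, 0) (4, c, i, 14),
          all (fun j => [&& Q (2, c, i, 0) (3, c, i, j),
                            Q (1, c, 0, 0) (4, c, i, j) &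
                            Q (3, c, i, j) (4, c, i, j)]) (iota 0 15) &
          all (fun j => Q (3, c, i, j) (3, c, i, j.+1) &&
                        Q (4, c, i, j) (4, c, i, j.+1)) (iota 0 14)])
    (iota 0 3)) (iota 0 3).

Lemma all_iotaP (n : nat) (Q : pred nat) (k : 'I_n) : all Q (iota 0 n) -> Q k.
Proof. by move=> /allP; apply; rewrite mem_iota /=. Qed.

Lemma all_hubsP Q h : all_hubs Q -> Q (hub_name h).
Proof.
move=> /andP[Q0 QP]; case: h => [|c|c i|t c i j] //=.
- by have /andP[] := all_iotaP c QP.
- by have /andP[_ /(all_iotaP i)/andP[]] := all_iotaP c QP.
- have /andP[_ /(all_iotaP i)/andP[_ /(all_iotaP j)/andP[]]] := all_iotaP c QP.
  by case: t.
Qed.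

Lemma all_edges_parent Q h : all_edges Q -> h != Root ->
  Q (hub_name (parent h)) (hub_name h).
Proof.
move=> QP; case: h => [|c|c i|t c i j] //= _.
- by have /andP[] := all_iotaP c QP.
- by have /andP[_ /(all_iotaP i)/and5P[]] := all_iotaP c QP.
- have /andP[_ /(all_iotaP i)/and5P[_ _ _ /(all_iotaP j)/and3P[]]] := all_iotaP c QP.
  by case: t.
Qed.

Lemma all_edges_long Q e : all_edges Q -> Q (hub_name (src e)) (hub_name (tgt e)).
Proof.
move=> QP; case: e => [c i j|t c i j|r c i] /=.
- by have /andP[_ /(all_iotaP i)/and5P[_ _ _ /(all_iotaP j)/and3P[]]] := all_iotaP c QP.
- have /andP[_ /(all_iotaP i)/and5P[_ _ _ _ /(all_iotaP j)/andP[]]] := all_iotaP c QP.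
  by rewrite /bump; case: t.
- have /andP[_ /(all_iotaP i)/and5P[_]] := all_iotaP c QP.
  by case: r.
Qed.

Definition same_point (p q : Z * Z) : bool := Z.eqb p.1 q.1 && Z.eqb p.2 q.2.

Lemma position_distinct :
  all_hubs (fun u => all_hubs (fun v => same_point (position u) (position v) ==> (u == v))).
Proof. by vm_compute. Qed.

Lemma position_off_edges :
  all_edges (fun u v => all_hubs (fun w =>
    if off_line (position u) (position v) (position w) then true
    else (w == u) || (w == v))).
Proof. by vm_compute. Qed.

Lemma position_edges_apart :
  all_edges (fun u v => all_edges (fun u' v' =>
    if apart (position u) (position v) (position u') (position v') then true
    else (u == u') && (v == v'))).
Proof. by vm_compute. Qed.

Definition edge (u v : hub) : Prop :=
  (v != Root /\ u = parent v) \/ exists e, src e = u /\ tgt e = v.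

Lemma all_edgesP Q u v : all_edges Q -> edge u v -> Q (hub_name u) (hub_name v).
Proof.
move=> QP [[v0 ->]|[e [<- <-]]]; first exact: all_edges_parent.
exact: all_edges_long.
Qed.

Lemma set2_eq (T : finType) (a b c d : T) : a != b ->
  [set a; b]%SET = [set c; d]%SET -> (a = c /\ b = d) \/ (a = d /\ b = c).
Proof.
move=> ab e; have : a \in [set c; d]%SET by rewrite -e !inE eqxx.
have : b \in [set c; d]%SET by rewrite -e !inE eqxx orbT.
rewrite !inE => /orP[]/eqP be /orP[]/eqP ae.
- by rewrite ae be eqxx in ab.
- by right.
- by left.
- by rewrite ae be eqxx in ab.
Qed.

Lemma long_nshort e : ~~ short (src e) (tgt e).
Proof. by case: e => [c i j|[] c i j|[] c i] //; rewrite /short andbF. Qed.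

Lemma long_ends_inj e e' :
  [set src e; tgt e]%SET = [set src e'; tgt e']%SET -> e = e'.
Proof.
move=> /(set2_eq (src_tgt e)).
case: e => [c i j|t c i j|r c i]; case: e' => [c' i' j'|t' c' i' j'|r' c' i'] /= [] [] //.
- by case=> -> -> ->.
- by case=> <- _ _ _ [].
- by case=> <- _ _ _ [].
- by case=> -> _ _ _ [].
- by case=> -> _ _ _ [].
- by case=> -> -> -> jj' _; congr Lane; apply/ord_inj.
(* Two lanes with exchanged ends would need each column to be the successor of the other. *)
- case=> _ _ _ jj' [_ _ _ j'j]; exfalso.
  by move: jj' j'j; rewrite /bump /=; lia.
- by move=> _; case: r r' => [] [] // [-> ->].
Qed.

Section Drawing.
Variable R : realType.

Definition hub_place (h : hub) : R * R := real_point R (position (hub_name h)).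

Lemma hub_place_inj : injective hub_place.
Proof.
move=> u v [e1 e2]; apply/hub_name_inj/eqP.
have /implyP := all_hubsP v (all_hubsP u position_distinct); apply.
by rewrite /same_point (Zreal_inj e1) (Zreal_inj e2) !Z.eqb_refl.
Qed.

(** Passes to the orientation in which [all_edges] lists the edge, replacing [t] by [1 - t] when it
    is reversed. *)
Lemma drawn_edge u v : drawn short src tgt u v -> exists u0 v0,
  [/\ edge u0 v0, [set u; v]%SET = [set u0; v0]%SET &
   forall t : R, t \in `]0, 1[%R -> exists2 t', t' \in `]0, 1[%R &
     segment (hub_place u) (hub_place v) t = segment (hub_place u0) (hub_place v0) t'].
Proof.
case=> [uv|[e [<- <-]]]; last first.
  by exists (src e), (tgt e); split=> [||t t01]; [right; exists e| |exists t].
have nroot a b : short a b -> parent a = b -> a != Root.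
  by move=> + ab; apply: contraTneq => a0; rewrite /short -ab a0.
have /andP[_ /orP[]/eqP e] := uv.
  exists v, u; split=> [||t t01].
  - by left; split=> //; exact: nroot uv e.
  - exact: finset.setUC.
  exists (1 - t)%R; last exact: segmentC.
  by move: t01; rewrite !in_itv /= => /andP[t0 t1]; apply/andP; split; lra.
exists u, v; split=> [||t t01] //; last by exists t.
by left; split=> //; apply: nroot e; rewrite short_sym.
Qed.

Lemma witness_planar : planar R witness.
Proof.
apply: (@subdivision_planar _ _ _ _ _ _ _ _ hub_place).
- exact: hub_place_inj.
- exact: long_ends_inj.
- move=> e u v uv; apply: contraL uv => /eqP.
  have nuv : short u v -> u != v by case/andP.
  case: (eqVneq u v) => [-> _|uv /(set2_eq uv)[[-> ->]|[-> ->]]].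
  + by rewrite short_irr.
  + exact: long_nshort.
  + by rewrite short_sym long_nshort.
- move=> u v w t /drawn_edge[u0 [v0 [uv0 _ /[apply] -[t' t01 ->]]]].
  have := all_hubsP w (all_edgesP position_off_edges uv0).
  have neq : hub_place u0 != hub_place v0.
    apply/eqP => /hub_place_inj uv; case: uv0 => [[v0r up]|[e [eu ev]]].
      by have := parent_neq v0r; rewrite -up uv eqxx.
    by have := src_tgt e; rewrite eu ev uv eqxx.
  case: ifP => [off _|_ /orP[]/eqP/hub_name_inj ->].
  + exact: off_line_segment off t01.
  + rewrite -[X in _ = X](segment0 _ (hub_place v0)) => /(segment_inj neq) t0.
    by move: t01; rewrite t0 in_itv /= ltxx.
  + rewrite -[X in _ = X](segment1 (hub_place u0)) => /(segment_inj neq) t1.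
    by move: t01; rewrite t1 in_itv /= ltxx andbF.
- move=> u v u' v' s t /drawn_edge[u0 [v0 [uv0 -> sP]]].
  move=> /drawn_edge[u1 [v1 [uv1 -> tP]]] neq /sP[s' s01 ->] /tP[t' t01 ->].
  have := all_edgesP (all_edgesP position_edges_apart uv0) uv1.
  case: ifP => [ap _|_ /andP[/eqP/hub_name_inj e /eqP/hub_name_inj e']].
    exact: apart_disjoint ap s01 t01.
  by rewrite e e' eqxx in neq.
- exact: src_tgt.
Qed.

End Drawing.

Theorem theorem5 (R : realType) :
  exists G : sgraph, planar R G /\ (5 <= geodesic_treewidth G)%N.
Proof. by exists witness; split; [exact: witness_planar|exact: witness_lower]. Qed.
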